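(* Let $H$ be a finite-dimensional non-cosemisimple Hopf algebra over $\Bbbk$ with no nontrivial skew-primitives, and let $H=\bigoplus_{n\ge 0,\,d_1,d_2\ge 1}B^{d_1,d_2}_n$ be a block system of $H$. Then there exist $\tau,\mu\in\widehat H$ with $d_\tau=d_\mu>1$ such that $B^{d_\tau,1}_1\ne 0$, $B^{1,d_\tau}_1\ne 0$, $B^{d_\tau,d_\mu}_k\ne 0$ and $B^{1,1}_m\ne 0$ for some $k,m>1$.
   Context: $\Bbbk$ is an algebraically closed field of characteristic $0$. A coalgebra is cosemisimple if it equals its coradical. $H$ has no nontrivial skew-primitives if every $x\in H$ with $\Delta(x)=x\otimes g+h\otimes x$ for some group-like elements $g,h$ of $H$ lies in the span of the group-like elements (equivalently, $H$ has no pointed Hopf subalgebra other than group algebras). Block systems. Let $C$ be a non-cosemisimple coalgebra (here the coalgebra underlying $H$) with coradical filtration $\{C_n\}_{n\ge 0}$. There is a coalgebra projection $\pi:C\to C_0$ onto the coradical whose kernel $I=\ker\pi$ is a coideal with $C=C_0\oplus I$; fix such $\pi$ and $I$. Put $\rho_L=(\pi\otimes \mathrm{id})\Delta$ and $\rho_R=(\mathrm{id}\otimes\pi)\Delta$; these make $C$ a $C_0$-bicomodule. Put $P_n=C_n\cap I$, a $C_0$-subbicomodule. Let $\widehat C$ index the simple subcoalgebras $D_\tau$ of $C$, with $\dim D_\tau=d_\tau^2$; let $V_\tau$ be the simple right $D_\tau$-comodule and $V_\tau^*$ the simple left $D_\tau$-comodule. The category of $C_0$-bicomodules is semisimple, and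 for a $C_0$-bicomodule $M$ one writes $M^{\tau,\mu}$ for the sum of the simple subbicomodules of $M$ isomorphic to $V_\tau^*\otimes V_\mu$, so $M=\bigoplus_{\tau,\mu\in\widehat C}M^{\tau,\mu}$. For each $n\ge 1$ choose a $C_0$-subbicomodule $Q_n\subseteq P_n$ with $P_n=P_{n-1}\oplus Q_n$ (so $Q_n\cong C_n/C_{n-1}$). The blocks (derived from $I$ and $\{Q_n\}$) are: $B^{d,d}_0=\bigoplus_{\tau\in\widehat C,\,d_\tau=d}D_\tau$; $B^{d_1,d_2}_0=0$ if $d_1\neq d_2$; and, for $n\ge 1$, $B^{d_1,d_2}_n=\bigoplus_{\tau,\mu\in\widehat C,\ d_\tau=d_1,\ d_\mu=d_2}Q_n^{\tau,\mu}$. The decomposition $C=\bigoplus_{n\ge 0,\,d_1,d_2\ge 1}B_n^{d_1,d_2}$ is called a block system of $C$. *)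

(* Defs.v *)
From HB Require Import structures.
From mathcomp Require Import all_boot all_order all_algebra all_field.
From mathcomp Require Import boolp.

Set Implicit Arguments.
Unset Strict Implicit.
Unset Printing Implicit Defensive.

Import GRing.Theory.
Local Open Scope ring_scope.

(* The tensor product of two finite-dimensional spaces is modelled by matrices
   of coordinates on the product of the bases vbasis {:U} and vbasis {:V}.
   [tens_elim f] is the linear map on the tensor product induced by a bilinear
   map f; it depends on the chosen bases only if f is not bilinear.  Thus
   [tens_elim (fun a b => E a b) (comul x)] is the Sweedler expression
   \sum_(x) E x_(1) x_(2). *)
Section Tensor.
Variable k : fieldType.

Definition tens (U V : vectType k) : Type := 'M[k]_(\dim {:U}, \dim {:V}).

Definition tensor (U V : vectType k) (u : U) (v : V) : tens U V :=
  \matrix_(i, j) (coord (vbasis {:U}) i u * coord (vbasis {:V}) j v).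

Definition tens_elim (U V W : vectType k) (f : U -> V -> W) (t : tens U V) : W :=
  \sum_i \sum_j t i j *: f (vbasis {:U})`_i (vbasis {:V})`_j.

End Tensor.

Notation "u ⊗ v" := (tensor u v) (at level 40, left associativity) : ring_scope.

Section TensorTheory.
Variable k : fieldType.
Implicit Types U V W : vectType k.

Lemma tensor_linearl U V (v : V) : linear (fun u : U => u ⊗ v).
Proof. by move=> a x y; apply/matrixP=> i j; rewrite !mxE linearP /= mulrDl mulrA. Qed.

Lemma tensor_linearr U V (u : U) : linear (fun v : V => u ⊗ v).
Proof. by move=> a x y; apply/matrixP=> i j; rewrite !mxE linearP /= mulrDr mulrCA. Qed.

Lemma tens_elim_linear U V W (f : U -> V -> W) : linear (tens_elim f).
Proof.
move=> a s t; rewrite /tens_elim scaler_sumr -big_split; apply: eq_bigr => i _ /=.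
rewrite scaler_sumr -big_split; apply: eq_bigr => j _ /=.
by rewrite !mxE scalerDl scalerA.
Qed.

Lemma tens_elim_tensor U V W (f : U -> V -> W) (u : U) (v : V) :
    (forall v, linear (f^~ v)) -> (forall u, linear (f u)) ->
  tens_elim f (u ⊗ v) = f u v.
Proof.
move=> fl fr.
pose Fl v' : {linear U -> W} := HB.pack (f^~ v') (GRing.isLinear.Build _ _ _ _ _ (fl v')).
pose Fr u' : {linear V -> W} := HB.pack (f u') (GRing.isLinear.Build _ _ _ _ _ (fr u')).
rewrite {2}(coord_vbasis (memvf u)) -[RHS]/(Fl v _) linear_sum /tens_elim.
apply: eq_bigr => i _; rewrite linearZ /= -[f _ v]/(Fr _ v).
rewrite {2}(coord_vbasis (memvf v)) linear_sum scaler_sumr.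
by apply: eq_bigr => j _; rewrite linearZ mxE scalerA.
Qed.

Lemma tens_sum U V (t : tens U V) :
  t = \sum_i \sum_j t i j *: ((vbasis {:U})`_i ⊗ (vbasis {:V})`_j).
Proof.
apply/matrixP=> i j; rewrite summxE (bigD1 i) //= summxE (bigD1 j) //=.
rewrite !mxE !coord_free ?(basis_free (vbasisP _)) // !eqxx !mulr1.
rewrite !big1 ?addr0 // => [i' ni|j' nj].
  rewrite summxE big1 // => j' _; rewrite !mxE !coord_free ?(basis_free (vbasisP _)) //.
  by move: ni; rewrite -val_eqE /= => /negPf->; rewrite mul0r mulr0.
rewrite !mxE !coord_free ?(basis_free (vbasisP _)) //.
by move: nj; rewrite -val_eqE /= => /negPf->; rewrite !mulr0.
Qed.

End TensorTheory.

Section TensorMaps.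
Variable k : fieldType.
Implicit Types U V W : vectType k.

Definition tens_map U V U' V' (f : U -> U') (g : V -> V') : tens U V -> tens U' V' :=
  tens_elim (fun u v => f u ⊗ g v).

Definition tens_assoc U V W : tens (tens U V) W -> tens U (tens V W) :=
  tens_elim (fun uv w => tens_elim (fun u v => u ⊗ (v ⊗ w)) uv).

Definition tens_mul (A : falgType k) (s t : tens A A) : tens A A :=
  tens_elim (fun a b => tens_elim (fun c d => (a * c) ⊗ (b * d)) t) s.

Definition tensv U V (A : {vspace U}) (B : {vspace V}) : {vspace tens U V} :=
  <<[seq u ⊗ v | u <- vbasis A, v <- vbasis B]>>%VS.

End TensorMaps.

HB.mixin Record isCoalgebra (k : fieldType) C of Vector k C := {
  comul : 'Hom(C, tens C C);
  counit : 'Hom(C, k^o);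
  comulA : forall x : C,
    tens_assoc (tens_map comul id (comul x)) = tens_map id comul (comul x);
  counitl : forall x : C, tens_elim (fun a b => counit a *: b) (comul x) = x;
  counitr : forall x : C, tens_elim (fun a b => counit b *: a) (comul x) = x
}.

#[short(type="coalgType")]
HB.structure Definition Coalgebra (k : fieldType) :=
  { C of isCoalgebra k C & Vector k C }.

HB.mixin Record isHopf (k : fieldType) H of Falgebra k H & isCoalgebra k H := {
  comul1 : comul (1 : H) = 1 ⊗ 1 :> tens H H;
  comulM : forall x y : H, comul (x * y) = tens_mul (comul x) (comul y) :> tens H H;
  counit1 : counit (1 : H) = 1 :> k;
  counitM : forall x y : H, counit (x * y) = counit x * counit y :> k;
  antipode : 'End(H);
  antipodel : forall x : H,
    tens_elim (fun a b => antipode a * b) (comul x) = (counit x : k)%:A;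
  antipoder : forall x : H,
    tens_elim (fun a b => a * antipode b) (comul x) = (counit x : k)%:A
}.

#[short(type="hopfAlgType")]
HB.structure Definition HopfAlgebra (k : fieldType) :=
  { H of isHopf k H & Falgebra k H & isCoalgebra k H }.

Section SumOfSubspaces.
Variables (k : fieldType) (V : vectType k).
Implicit Types (P : {vspace V} -> Prop) (U W : {vspace V}).

Lemma sumv_pred_exists P : exists U : {vspace V},
  (forall W, P W -> (W <= U)%VS) /\
  (forall U', (forall W, P W -> (W <= U')%VS) -> (U <= U')%VS).
Proof.
pose S := [pred n | `[< exists2 s : seq {vspace V},
  forall W, W \in s -> P W & \dim (\sum_(W <- s) W)%VS = n >]].
have S0 : exists n, S n.
  by exists 0%N; apply/asboolP; exists [::]; rewrite ?big_nil ?dimv0.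
have Sle n : S n -> (n <= \dim {:V})%N.
  by move=> /asboolP[s _ <-]; apply/dimvS/subvf.
have [n /asboolP[s sP <-] smax] := ex_maxnP S0 Sle.
exists (\sum_(W <- s) W)%VS; split=> [W PW|U' U'P].
  have := smax (\dim (\sum_(W' <- W :: s) W')%VS); rewrite big_cons => le.
  suff /eqP-> : (\sum_(W' <- s) W' == W + \sum_(W' <- s) W')%VS by apply: addvSl.
  rewrite eqEdim addvSr le //; apply/asboolP; exists (W :: s); last by rewrite big_cons.
  by move=> W'; rewrite inE => /orP[/eqP->|/sP].
by rewrite big_seq; apply: (big_ind (fun A => (A <= U')%VS)) => [|A B|W /sP/U'P//]; rewrite ?sub0v // subv_add => -> ->.
Qed.

(* The sum of all subspaces satisfying P; there may be infinitely many. *)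
Definition sumv_pred P : {vspace V} := sval (cid (sumv_pred_exists P)).

End SumOfSubspaces.

Section Coalgebras.
Variables (k : fieldType) (C : coalgType k).
Implicit Types (D E : {vspace C}) (x g h : C).

Definition group_like g : Prop := comul g = g ⊗ g :> tens C C /\ counit g = 1 :> k.

Definition group_like_span : {vspace C} :=
  sumv_pred (fun L => exists2 g, group_like g & L = <[g]>%VS).

Definition no_nontrivial_skew_primitives : Prop := forall x g h,
  group_like g -> group_like h ->
  comul x = x ⊗ g + h ⊗ x :> tens C C -> x \in group_like_span.

Definition subcoalgebra D : Prop := forall x, x \in D -> comul x \in tensv D D.

Definition simple_subcoalgebra D : Prop :=
  [/\ subcoalgebra D, D <> 0%VS &
      forall E, subcoalgebra E -> (E <= D)%VS -> E = 0%VS \/ E = D].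

Definition coradical : {vspace C} := sumv_pred simple_subcoalgebra.

Definition cosemisimple : Prop := coradical = {:C}%VS.

Fixpoint corad_filtration (n : nat) : {vspace C} :=
  if n is m.+1 then
    (comul @^-1: (tensv {:C} (corad_filtration m) + tensv coradical {:C}))%VS
  else coradical.

(* Comodules over a subcoalgebra D are comodules over C whose coaction has
   coefficients in D. *)
Definition left_comodule D (W : vectType k) (l : 'Hom(W, tens C W)) : Prop :=
  [/\ forall w, l w \in tensv D {:W},
      forall w, tens_assoc (tens_map comul id (l w)) = tens_map id l (l w) &
      forall w, tens_elim (fun c w' => (counit c : k) *: w') (l w) = w].

Definition right_comodule D (V : vectType k) (r : 'Hom(V, tens V C)) : Prop :=
  [/\ forall v, r v \in tensv {:V} D,
      forall v, tens_assoc (tens_map r id (r v)) = tens_map id comul (r v) &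
      forall v, tens_elim (fun v' c => (counit c : k) *: v') (r v) = v].

Definition simple_left_comodule D (W : vectType k) (l : 'Hom(W, tens C W)) : Prop :=
  [/\ left_comodule D l, {:W}%VS <> 0%VS &
      forall A : {vspace W}, (forall w, w \in A -> l w \in tensv {:C} A) ->
        A = 0%VS \/ A = {:W}%VS].

Definition simple_right_comodule D (V : vectType k) (r : 'Hom(V, tens V C)) : Prop :=
  [/\ right_comodule D r, {:V}%VS <> 0%VS &
      forall A : {vspace V}, (forall v, v \in A -> r v \in tensv A {:C}) ->
        A = 0%VS \/ A = {:V}%VS].

End Coalgebras.

Arguments coradical {k C}.
Arguments corad_filtration {k C}.

Section BlockSystems.
Variables (k : fieldType) (C : coalgType k) (pi : 'End(C)).
Implicit Types (M N D : {vspace C}) (Q : nat -> {vspace C}).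

(* As pi is a coalgebra map, its kernel is a coideal, complementary to the
   coradical. *)
Definition coradical_projection : Prop :=
  [/\ limg pi = coradical,
      forall x, x \in coradical -> pi x = x,
      forall x, comul (pi x) = tens_map pi pi (comul x) :> tens C C &
      forall x, counit (pi x) = counit x :> k].

Definition rhoL (x : C) : tens C C := tens_map pi id (comul x).
Definition rhoR (x : C) : tens C C := tens_map id pi (comul x).

Definition subbicomodule N : Prop := forall x, x \in N ->
  rhoL x \in tensv coradical N /\ rhoR x \in tensv N coradical.

Definition simple_subbicomodule N : Prop :=
  [/\ subbicomodule N, N <> 0%VS &
      forall M, subbicomodule M -> (M <= N)%VS -> M = 0%VS \/ M = N].

(* N is isomorphic, as a bicomodule over the coradical, to the tensor product
   of the simple left comodule W of D and the simple right comodule V of E;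
   W and V are unique up to isomorphism. *)
Definition iso_simple_tensor D E N : Prop :=
  exists (W V : vectType k) (l : 'Hom(W, tens C W)) (r : 'Hom(V, tens V C))
         (f : 'Hom(tens W V, C)),
    [/\ simple_left_comodule D l /\ simple_right_comodule E r,
        lker f = 0%VS /\ limg f = N,
        forall w v, rhoL (f (w ⊗ v)) = tens_elim (fun c w' => c ⊗ f (w' ⊗ v)) (l w) &
        forall w v, rhoR (f (w ⊗ v)) = tens_elim (fun v' c => f (w ⊗ v') ⊗ c) (r v)].

Definition isotypic M D E : {vspace C} := sumv_pred (fun N =>
  [/\ simple_subbicomodule N, (N <= M)%VS & iso_simple_tensor D E N]).

Definition filtration_part (n : nat) : {vspace C} :=
  (corad_filtration n :&: lker pi)%VS.

(* Only the values Q n for n >= 1 matter. *)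
Definition block_complements Q : Prop := forall n,
  [/\ subbicomodule (Q n.+1),
      (filtration_part n + Q n.+1)%VS = filtration_part n.+1 &
      (filtration_part n :&: Q n.+1)%VS = 0%VS].

(* A simple subcoalgebra D_tau has dimension d_tau ^ 2. *)
Definition degree D (d : nat) : Prop := \dim D = (d ^ 2)%N.

Definition block Q (n d1 d2 : nat) : {vspace C} :=
  if n is 0 then
    if d1 == d2 then sumv_pred (fun D => simple_subcoalgebra D /\ degree D d1)
    else 0%VS
  else sumv_pred (fun M => exists D E,
    [/\ simple_subcoalgebra D /\ degree D d1,
        simple_subcoalgebra E /\ degree E d2 & M = isotypic (Q n) D E]).

End BlockSystems.

(* Main.v *)
(* The dual algebra A = H^* acts on H from both sides by x |-> x_1 f(x_2) and x |-> f(x_1) x_2,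
   and C_n is the annihilator of the (n+1)-st power of the radical, the annihilator of the
   coradical.  By Larson and Sweedler H is free of rank one over A on both sides, so an injective
   hull x |-> e(x_1) x_2 of the comodules over a simple subcoalgebra D is generated by one element y,
   and its top lies in the (D, E)-component, where E is the image of D under a coalgebra
   automorphism (the transposed Nakayama automorphism) and so has the same degree as D.

   For D = k1 the hull is not contained in the coradical, since otherwise e would be a normalised
   integral and H cosemisimple; without skew-primitives its top is not at level one, whence
   B_m^{1,1} <> 0 with m > 1.  A simple constituent of its second layer gives B_1^{1,d} <> 0 with
   d > 1, and the antipode turns this into B_1^{d,1} <> 0 for some D' of degree d.  The top of the
   hull of D' lies in a (d,d)-component; it cannot be at level one, because that level also
   contains the trivial comodule found before. *)
From HB Require Import structures.
Require Import Defs.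
From mathcomp Require Import all_boot all_order all_algebra all_field.
From mathcomp Require Import boolp.

Set Implicit Arguments.
Unset Strict Implicit.
Unset Printing Implicit Defensive.

Import GRing.Theory.
Local Open Scope ring_scope.

(** * Tensors and slices *)

(** The criterion [block_neq0] asks only for an element of C_(n+1) outside C_n that is sent into C_n
    by the functionals killing D on the left leg and by those killing E on the right leg. Block
    claims thereby become membership statements about the C_n, independent of [pi] and of the
    complements; matrix units recover from such an element an actual bicomodule of type (D, E)
    inside [Q]. Degrees enter through matrix coefficients: a simple subquotient of dimension d gives
    a d by d matrix of elements of the coradical. Burnside's theorem, where algebraic closedness is
    used, makes these elements independent, so that they span a simple subcoalgebra of dimension
    d^2. The hull of D is the image of [ract e] for an idempotent functional e attached to D. Having
    one generator controls the hull as a whole: what a functional does to the generator modulo C_n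
    passes to every element. This is how a top at level one would force a single type on the whole
    second layer. *)

Notation dual V := 'Hom(V, (_^o)%type).

Definition bilinear_fun (k : fieldType) (U V W : vectType k) (f : U -> V -> W) :=
  (forall v, linear (f^~ v)) /\ (forall u, linear (f u)).

Section LinearClosure.
Variable k : fieldType.
Implicit Types U V W : vectType k.

Definition lfun_of U V (f : U -> V) (lf : linear f) : 'Hom(U, V) :=
  let F : {linear U -> V} := HB.pack f (GRing.isLinear.Build _ _ _ _ _ lf) in
  linfun F.

Lemma lfun_ofE U V (f : U -> V) (lf : linear f) x : lfun_of lf x = f x.
Proof. by rewrite lfunE. Qed.

Lemma is_linear_id U : linear (fun x : U => x).
Proof. by []. Qed.

Lemma is_linear_lfun U V W (f : 'Hom(V, W)) (g : U -> V) :
  linear g -> linear (fun x => f (g x)).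
Proof. by move=> lg a x y; rewrite lg linearP. Qed.

Lemma is_linear_scaler U V (a : k) (g : U -> V) :
  linear g -> linear (fun x => a *: g x).
Proof. by move=> lg b x y; rewrite lg scalerDr !scalerA mulrC. Qed.

Lemma is_linear_scalel U V (g : U -> k^o) (v : V) :
  linear g -> linear (fun x => g x *: v).
Proof. by move=> lg b x y; rewrite lg scalerDl scalerA. Qed.

Lemma is_linear_add U V (f g : U -> V) :
  linear f -> linear g -> linear (fun x => f x + g x).
Proof. by move=> lf lg b x y; rewrite lf lg scalerDr addrACA. Qed.

Lemma is_linear_sum I (r : seq I) U V (f : I -> U -> V) :
  (forall i, linear (f i)) -> linear (fun x => \sum_(i <- r) f i x).
Proof.
move=> lf b x y; rewrite scaler_sumr -big_split; apply: eq_bigr => i _.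
exact: lf.
Qed.

Lemma is_linear_mull (A : falgType k) U (a : A) (g : U -> A) :
  linear g -> linear (fun x => a * g x).
Proof. by move=> lg b x y; rewrite lg mulrDr scalerAr. Qed.

Lemma is_linear_mulr (A : falgType k) U (a : A) (g : U -> A) :
  linear g -> linear (fun x => g x * a).
Proof. by move=> lg b x y; rewrite lg mulrDl scalerAl. Qed.

Lemma is_linear_tensorl U V W (g : W -> U) (v : V) :
  linear g -> linear (fun x => g x ⊗ v).
Proof. by move=> lg b x y; rewrite lg (tensor_linearl v). Qed.

Lemma is_linear_tensorr U V W (g : W -> V) (u : U) :
  linear g -> linear (fun x => u ⊗ g x).
Proof. by move=> lg b x y; rewrite lg (tensor_linearr u). Qed.

Lemma is_linear_tens_elim U V W (X : vectType k) (f : U -> V -> W) (g : X -> tens U V) :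
  linear g -> linear (fun x => tens_elim f (g x)).
Proof. by move=> lg b x y; rewrite lg tens_elim_linear. Qed.

Lemma is_linear_tens_elim_fun U V W (X : vectType k) (f : X -> U -> V -> W) (t : tens U V) :
  (forall u v, linear (fun x => f x u v)) ->
  linear (fun x => tens_elim (f x) t).
Proof.
move=> lf; apply: is_linear_sum => i; apply: is_linear_sum => j.
exact/is_linear_scaler/lf.
Qed.

Lemma is_linear_coord n U V (X : n.-tuple V) i (g : U -> V) :
  linear g -> linear (fun x => (coord X i (g x) : k^o)).
Proof. by move=> lg a x y; rewrite lg linearP. Qed.

Lemma is_linear_entry U W V (i : 'I_(\dim {:U})) (j : 'I_(\dim {:V})) (g : W -> tens U V) :
  linear g -> linear (fun x => (g x i j : k^o)).
Proof. by move=> lg a x y; rewrite lg !mxE. Qed.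

End LinearClosure.

(** [tens_elim] has its universal property only for bilinear arguments, so each Sweedler rewriting
    below leaves linearity goals; this tactic closes them by following the shape of the
    expression. *)
Ltac lin :=
  repeat first
   [ exact: is_linear_id
   | exact: tens_elim_linear
   | exact: (is_linear_scaler _ (@is_linear_id _ _))
   | exact: (is_linear_mull _ (@is_linear_id _ _))
   | exact: tensor_linearr
   | exact: tensor_linearl
   | progress intros
   | assumption
   | lazymatch goal with |- bilinear_fun _ => split end
   | match goal with H : bilinear_fun ?f |- GRing.linear_for _ (?f _) => exact: (proj2 H) end
   | lazymatch goal with
     | |- GRing.linear_for _ (fun x => x) => exact: is_linear_id
     | |- GRing.linear_for _ (fun x => _ + _) => apply: is_linear_add
     | |- GRing.linear_for _ (fun x => fun_of_lfun ?f _) => apply: is_linear_lfun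
     | |- GRing.linear_for _ (fun x => _ *: _) =>
        first [apply: is_linear_scaler | apply: is_linear_scalel]
     | |- GRing.linear_for _ (fun x => _ * _) =>
        first [apply: is_linear_mull | apply: is_linear_mulr]
     | |- GRing.linear_for _ (fun x => tensor _ _) =>
        first [apply: is_linear_tensorr | apply: is_linear_tensorl]
     | |- GRing.linear_for _ (fun x => tens_elim _ _) =>
        first [apply: is_linear_tens_elim | apply: is_linear_tens_elim_fun]
     | |- GRing.linear_for _ (fun x => coord ?f ?i _) => apply: is_linear_coord
     | |- GRing.linear_for _ (fun x => fun_of_matrix _ _ _) => apply: is_linear_entry
     | |- GRing.linear_for _ (fun x => \sum_(i <- _) _) => apply: is_linear_sum
     | |- GRing.linear_for _ (fun_of_lfun ?f) => apply: (is_linear_lfun f (@is_linear_id _ _))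
     end
   | match goal with
     | H : bilinear_fun ?f |- GRing.linear_for _ (fun x => ?f _ _) =>
        first [exact: (proj1 H) | exact: (proj2 H)]
     | H : (forall _, _) |- _ => apply: H
     end ].

Section Slices.
Variable k : fieldType.
Implicit Types U V W : vectType k.

Lemma eq_tens_elim U V W (f g : U -> V -> W) t :
  (forall u v, f u v = g u v) -> tens_elim f t = tens_elim g t.
Proof. by move=> fg; apply: eq_bigr => i _; apply: eq_bigr => j _; rewrite fg. Qed.

Lemma linear0_fun U V (f : U -> V) : linear f -> f 0 = 0.
Proof. by move=> lf; rewrite -(lfun_ofE lf) linear0. Qed.

Lemma linear_sum_fun I (r : seq I) P U V (f : U -> V) (F : I -> U) :
  linear f -> f (\sum_(i <- r | P i) F i) = \sum_(i <- r | P i) f (F i).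
Proof.
by move=> lf; rewrite -(lfun_ofE lf) linear_sum; apply: eq_bigr => i _; exact: lfun_ofE.
Qed.

Lemma linearZ_fun U V (f : U -> V) a u : linear f -> f (a *: u) = a *: f u.
Proof. by move=> lf; rewrite -!(lfun_ofE lf) linearZ. Qed.

Lemma linearB_fun U V (f : U -> V) x y : linear f -> f (x - y) = f x - f y.
Proof. by move=> lf; rewrite -!(lfun_ofE lf) linearB. Qed.

Lemma linearD_fun U V (f : U -> V) x y : linear f -> f (x + y) = f x + f y.
Proof. by move=> lf; rewrite -!(lfun_ofE lf) linearD. Qed.

Lemma tens_elim_lin U V W (X : vectType k) (L : W -> X) (f : U -> V -> W) t :
  linear L -> L (tens_elim f t) = tens_elim (fun u v => L (f u v)) t.
Proof.
move=> lL; rewrite /tens_elim linear_sum_fun //; apply: eq_bigr => i _.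
by rewrite linear_sum_fun //; apply: eq_bigr => j _; rewrite linearZ_fun.
Qed.

Lemma tens_elim_sum n U V W (F : 'I_n -> U -> V -> W) t :
  tens_elim (fun u v => \sum_i F i u v) t = \sum_i tens_elim (F i) t.
Proof.
rewrite [RHS]exchange_big; apply: eq_bigr => a _ /=.
rewrite [RHS]exchange_big; apply: eq_bigr => b _ /=.
by rewrite scaler_sumr.
Qed.

Lemma tens_elimE U V W (f : U -> V -> W) u v :
  bilinear_fun f -> tens_elim f (u ⊗ v) = f u v.
Proof. by case=> fl fr; rewrite tens_elim_tensor. Qed.

Lemma tens_elim_map U V U' V' W (f : U -> U') (g : V -> V') (F : U' -> V' -> W) t :
  bilinear_fun F -> tens_elim F (tens_map f g t) = tens_elim (fun u v => F (f u) (g v)) t.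
Proof.
move=> bF; rewrite /tens_map tens_elim_lin; last exact: tens_elim_linear.
by apply: eq_tens_elim => u v; rewrite tens_elimE.
Qed.

Lemma tens_elim_id U V (t : tens U V) : tens_elim (fun u v => u ⊗ v) t = t.
Proof. by rewrite [RHS]tens_sum. Qed.

(** Matrix entries are themselves pairings: the (i, j) entry is the value of the tensor under two
    coordinate functionals. *)
Lemma tens_separate U V (s t : tens U V) :
  (forall (f : dual U) (g : dual V),
     tens_elim (fun u v => f u *: g v) s = tens_elim (fun u v => f u *: g v) t) -> s = t.
Proof.
move=> st; apply/matrixP => i j.
have lc (X : vectType k) m (Y : m.-tuple X) l : linear (fun x : X => (coord Y l x : k^o)) by lin.
have E (r : tens U V) : (r i j : k^o) =
    tens_elim (W := k^o) (fun u v => lfun_of (lc U _ (vbasis {:U}) i) u *: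
                          lfun_of (lc V _ (vbasis {:V}) j) v) r.
  have -> : (r i j : k^o) = tens_elim (W := k^o) (fun u v => ((u ⊗ v) i j : k^o)) r.
    by rewrite -[in LHS](tens_elim_id r) (tens_elim_lin (L := fun t : tens U V => (t i j : k^o))) //; lin.
  by apply: eq_tens_elim => u v; rewrite !mxE !lfun_ofE.
by have := st (lfun_of (lc U _ (vbasis {:U}) i)) (lfun_of (lc V _ (vbasis {:V}) j)); rewrite -!E.
Qed.

Lemma functional_separate V (x y : V) : (forall f : dual V, f x = f y) -> x = y.
Proof.
move=> xy; rewrite (coord_vbasis (memvf x)) (coord_vbasis (memvf y)).
apply: eq_bigr => i _; congr (_ *: _).
have lc : linear (fun x : V => (coord (vbasis {:V}) i x : k^o)) by lin.
by have := xy (lfun_of lc); rewrite !lfun_ofE.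
Qed.

Definition slicel U V (f : dual U) (t : tens U V) : V := tens_elim (fun u v => f u *: v) t.
Definition slicer U V (g : dual V) (t : tens U V) : U := tens_elim (fun u v => g v *: u) t.

Lemma slicel_linear U V (f : dual U) : linear (@slicel U V f).
Proof. exact: tens_elim_linear. Qed.

Lemma slicer_linear U V (f : dual V) : linear (@slicer U V f).
Proof. exact: tens_elim_linear. Qed.

Lemma slicel_tensor U V (f : dual U) (u : U) (v : V) : slicel f (u ⊗ v) = f u *: v.
Proof. by rewrite /slicel tens_elimE //; lin. Qed.

Lemma slicer_tensor U V (f : dual V) (u : U) (v : V) : slicer f (u ⊗ v) = f v *: u.
Proof. by rewrite /slicer tens_elimE //; lin. Qed.

Lemma tensor_suml I (r : seq I) U V (F : I -> U) (v : V) :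
  (\sum_(i <- r) F i) ⊗ v = \sum_(i <- r) F i ⊗ v.
Proof. exact: (linear_sum_fun _ _ _ (tensor_linearl v)). Qed.

Lemma tensor_sumr I (r : seq I) U V (F : I -> V) (u : U) :
  u ⊗ (\sum_(i <- r) F i) = \sum_(i <- r) u ⊗ F i.
Proof. exact: (linear_sum_fun _ _ _ (tensor_linearr u)). Qed.

Lemma tensorZl U V a (u : U) (v : V) : (a *: u) ⊗ v = a *: (u ⊗ v).
Proof. exact: (linearZ_fun _ _ (tensor_linearl v)). Qed.

Lemma tensorZr U V a (u : U) (v : V) : u ⊗ (a *: v) = a *: (u ⊗ v).
Proof. exact: (linearZ_fun _ _ (tensor_linearr u)). Qed.

Lemma tensor_mem U V (A : {vspace U}) (B : {vspace V}) u v :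
  u \in A -> v \in B -> u ⊗ v \in tensv A B.
Proof.
move=> uA vB; rewrite (coord_vbasis uA) (coord_vbasis vB).
rewrite tensor_suml; apply: memv_suml => i _; rewrite tensorZl.
apply: memvZ; rewrite tensor_sumr; apply: memv_suml => j _; rewrite tensorZr.
apply: memvZ; apply: memv_span; apply/allpairsP.
exists ((vbasis A)`_i, (vbasis B)`_j); split=> //; apply: mem_nth; by rewrite size_tuple.
Qed.

Lemma tensv_ind U V W (A : {vspace U}) (B : {vspace V}) (X : {vspace W}) (L : tens U V -> W) t :
  linear L -> (forall u v, u \in A -> v \in B -> L (u ⊗ v) \in X) ->
  t \in tensv A B -> L t \in X.
Proof.
move=> lL LX tAB; rewrite -(lfun_ofE lL) memv_preim; apply: subvP tAB.
apply/span_subvP => _ /allpairsP[[u v] /= [uA vB ->]].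
by rewrite -memv_preim lfun_ofE; apply: LX; apply: vbasis_mem.
Qed.

Lemma slicel_mem U V (A : {vspace U}) (B : {vspace V}) t f :
  t \in tensv A B -> slicel f t \in B.
Proof.
apply: tensv_ind; first exact: slicel_linear.
by move=> u v _ vB; rewrite slicel_tensor memvZ.
Qed.

Lemma slicer_mem U V (A : {vspace U}) (B : {vspace V}) t f :
  t \in tensv A B -> slicer f t \in A.
Proof.
apply: tensv_ind; first exact: slicer_linear.
by move=> u v uA _; rewrite slicer_tensor memvZ.
Qed.

Lemma slicel_eq0 U V (A : {vspace U}) (B : {vspace V}) t (f : dual U) :
  (forall u, u \in A -> f u = 0) -> t \in tensv A B -> slicel f t = 0.
Proof.
move=> fA tAB; apply/eqP; rewrite -memv0; apply: tensv_ind tAB; first exact: slicel_linear.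
by move=> u v uA _; rewrite slicel_tensor fA // scale0r mem0v.
Qed.

Definition dbasis V i : dual V := lfun_of (is_linear_coord (vbasis {:V}) i (@is_linear_id k V)).

Lemma dbasis_sum V (v : V) : v = \sum_(i < \dim {:V}) dbasis i v *: (vbasis {:V})`_i.
Proof. by rewrite [LHS](coord_vbasis (memvf v)); apply: eq_bigr => i _; rewrite lfun_ofE. Qed.

Lemma dbasis_comb V (a : 'I_(\dim {:V}) -> k) j :
  dbasis j (\sum_(i < \dim {:V}) a i *: (vbasis {:V})`_i) = a j.
Proof. by rewrite lfun_ofE coord_sum_free // (basis_free (vbasisP _)). Qed.

Lemma dual_dbasis V (f : dual V) : f = \sum_(i < \dim {:V}) f (vbasis {:V})`_i *: dbasis i.
Proof.
apply/lfunP => x; rewrite {1}(dbasis_sum x) linear_sum sum_lfunE.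
by apply: eq_bigr => i _; rewrite linearZ scale_lfunE /= /GRing.scale /= mulrC.
Qed.

Lemma slicelE U V (f : dual U) (g : dual V) t :
  g (slicel f t) = tens_elim (fun u v => f u *: g v) t.
Proof.
rewrite /slicel tens_elim_lin; last by lin.
by apply: eq_tens_elim => u v; rewrite linearZ.
Qed.

Lemma slicerE U V (f : dual U) (g : dual V) t :
  f (slicer g t) = tens_elim (fun u v => f u *: g v) t.
Proof.
rewrite /slicer tens_elim_lin; last by lin.
by apply: eq_tens_elim => u v; rewrite linearZ /= /GRing.scale /= mulrC.
Qed.

(** Since the left slices lie in [B], t is the sum over a basis b_j of [B] of t_j ⊗ b_j, where t_j
    is the slice of t by the j-th coordinate functional and lies in [A]. *)
Lemma tensvP U V (A : {vspace U}) (B : {vspace V}) t :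
  (forall f, slicel f t \in B) -> (forall f, slicer f t \in A) -> t \in tensv A B.
Proof.
move=> tB tA.
have lc j : linear (fun v : V => (coord (vbasis B) j v : k^o)) by lin.
suff -> : t = \sum_j slicer (lfun_of (lc j)) t ⊗ (vbasis B)`_j.
  apply: memv_suml => j _; apply: tensor_mem => //.
  by apply/vbasis_mem/mem_nth; rewrite size_tuple.
apply: tens_separate => f g.
rewrite -!slicelE; congr (g _).
rewrite (linear_sum_fun _ _ _ (@slicel_linear _ _ f)) [LHS](coord_vbasis (tB f)).
apply: eq_bigr => j _; rewrite slicel_tensor; congr (_ *: _).
by have := slicerE f (lfun_of (lc j)) t; rewrite -slicelE lfun_ofE.
Qed.

(** Split the identity of [U] as (1 - p) + p with p a projection onto [A]; any functional composed
    with 1 - p vanishes on [A]. This turns the wedge in the definition of the coradical filtration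
    into a condition on functionals that kill the coradical. *)
Lemma mem_tens_sum U V (A : {vspace U}) (B : {vspace V}) (t : tens U V) :
  (t \in (tensv {:U} B + tensv A {:V})%VS) <->
  (forall f : dual U, (forall a, a \in A -> f a = 0) -> slicel f t \in B).
Proof.
split=> [/memv_addP[s sB [r rA ->]] f fA|tB].
  rewrite (linearD_fun _ _ (@slicel_linear _ _ f)) (slicel_eq0 fA rA) addr0.
  exact: slicel_mem sB.
pose p := projv A.
have -> : t = tens_map (\1 - p)%VF \1%VF t + tens_map p \1%VF t.
  rewrite /tens_map -[LHS]tens_elim_id /tens_elim -big_split; apply: eq_bigr => i _ /=.
  rewrite -big_split; apply: eq_bigr => j _ /=; rewrite -scalerDr; congr (_ *: _).
  rewrite -(linearD_fun _ _ (tensor_linearl _)).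
  by rewrite add_lfunE opp_lfunE subrK !id_lfunE.
apply: memv_add; apply: tensvP => f; rewrite ?memvf //.
  have E : slicel f (tens_map (\1 - p)%VF \1%VF t) = slicel (f \o (\1 - p))%VF t.
    rewrite /slicel tens_elim_map; last by lin.
    by apply: eq_tens_elim => u v; rewrite comp_lfunE id_lfunE.
  rewrite E; apply: tB => a aA.
  by rewrite comp_lfunE add_lfunE opp_lfunE id_lfunE projv_id // subrr linear0.
rewrite /tens_map /slicer tens_elim_lin; last exact: tens_elim_linear.
apply: memv_suml => i _; apply: memv_suml => j _; apply/memvZ.
by rewrite -/(slicer f _) slicer_tensor memvZ ?memv_proj.
Qed.

End Slices.

(** * Hit actions of the dual algebra and the coradical filtration *)

Section SumvPred.
Variables (k : fieldType) (V : vectType k).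
Implicit Types (P : {vspace V} -> Prop) (U W : {vspace V}).

Lemma sumv_pred_sup P W : P W -> (W <= sumv_pred P)%VS.
Proof. by rewrite /sumv_pred; case: cid => /= U [sup _]; apply: sup. Qed.

Lemma sumv_pred_min P U : (forall W, P W -> (W <= U)%VS) -> (sumv_pred P <= U)%VS.
Proof. by rewrite /sumv_pred; case: cid => /= ? [_ min]; apply: min. Qed.

Lemma sumv_pred_neq0 P W : P W -> W <> 0%VS -> sumv_pred P <> 0%VS.
Proof.
by move=> PW W0 P0; apply: W0; apply/eqP; rewrite -subv0 -P0; apply: sumv_pred_sup.
Qed.

Definition annihilates (f : dual V) (A : {vspace V}) := forall a, a \in A -> f a = 0.

(** For any functional f, the composite of f with 1 - [projv A] kills [A], so x and its projection
    to [A] have the same values. *)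
Lemma vspace_separate (A : {vspace V}) x :
  (forall f, annihilates f A -> f x = 0) -> x \in A.
Proof.
move=> fx; suff -> : x = projv A x by apply: memv_proj.
apply: functional_separate => f; apply/eqP; rewrite -subr_eq0; apply/eqP.
have fA : annihilates (f \o (\1 - projv A))%VF A.
  move=> a aA; rewrite comp_lfunE add_lfunE opp_lfunE id_lfunE.
  by rewrite projv_id // subrr linear0.
by have := fx _ fA; rewrite comp_lfunE add_lfunE opp_lfunE id_lfunE linearB.
Qed.

Lemma separating_functional (A : {vspace V}) x :
  x \notin A -> exists2 f : dual V, annihilates f A & f x = 1.
Proof.
move=> xA; have [f [fA fx]] : exists f, annihilates f A /\ f x != 0.
  apply: contrapT => nf; move/negP: xA; apply; apply: vspace_separate => f fA.
  by apply: contrapT => /eqP fx; apply: nf; exists f.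
exists ((f x)^-1 *: f) => [a aA|]; rewrite scale_lfunE; last exact: mulVf.
by rewrite (fA a aA) scaler0.
Qed.

End SumvPred.

Section Coalgebra.
Variables (k : fieldType) (C : coalgType k).
Implicit Types (f g h : dual C) (x y : C) (D : {vspace C}).

Lemma sw_assoc (W : vectType k) (F : C -> C -> C -> W) x :
  (forall b c, linear (fun a => F a b c)) -> (forall a c, linear (fun b => F a b c)) ->
  (forall a b, linear (fun c => F a b c)) ->
  tens_elim (fun a b => tens_elim (fun c d => F a c d) (comul b)) (comul x) =
  tens_elim (fun a b => tens_elim (fun c d => F c d b) (comul a)) (comul x).
Proof.
move=> F1 F2 F3; pose T (t : tens C (tens C C)) := tens_elim (fun u vw => tens_elim (F u) vw) t.
have lT : linear T by exact: tens_elim_linear.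
have bT : bilinear_fun (fun u (vw : tens C C) => tens_elim (F u) vw) by lin.
have bT' u : bilinear_fun (F u) by lin.
transitivity (T (tens_map id comul (comul x))); first by rewrite /T tens_elim_map.
rewrite -comulA /tens_assoc /T tens_elim_lin //.
rewrite tens_elim_map; last by rewrite /T; lin.
apply: eq_tens_elim => u v; rewrite tens_elim_lin //.
by apply: eq_tens_elim => a b; rewrite /T !tens_elimE.
Qed.

Lemma lact_subproof f : linear (fun x : C => slicer f (comul x)).
Proof. by move=> a x y; rewrite linearP slicer_linear. Qed.

Lemma ract_subproof f : linear (fun x : C => slicel f (comul x)).
Proof. by move=> a x y; rewrite linearP slicel_linear. Qed.

Definition lact f : 'End(C) := lfun_of (lact_subproof f).
Definition ract f : 'End(C) := lfun_of (ract_subproof f).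
(** The convolution product f(x_1) g(x_2) of the dual algebra, written as a composite so that it is
    linear by construction. *)
Definition conv f g : dual C := (f \o lact g)%VF.

Lemma lactE f x : lact f x = slicer f (comul x). Proof. exact: lfun_ofE. Qed.
Lemma ractE f x : ract f x = slicel f (comul x). Proof. exact: lfun_ofE. Qed.

Lemma conv_lact f g x : conv f g x = f (lact g x).
Proof. exact: comp_lfunE. Qed.

Lemma convE f g x : conv f g x = tens_elim (fun a b => f a *: g b) (comul x).
Proof. by rewrite conv_lact lactE slicerE. Qed.

Lemma conv_ract f g x : conv f g x = g (ract f x).
Proof. by rewrite convE ractE slicelE. Qed.

Lemma convA f g h x : conv f (conv g h) x = conv (conv f g) h x.
Proof.
rewrite !convE; transitivity (tens_elim (fun a b =>
   tens_elim (fun c d => f a *: (g c *: h d)) (comul b)) (comul x)).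
  by apply: eq_tens_elim => a b; rewrite convE tens_elim_lin //; lin.
rewrite [LHS](sw_assoc (F := fun a b c => f a *: (g b *: h c))); try by lin.
apply: eq_tens_elim => a b; rewrite convE (tens_elim_lin (L := fun z : k^o => z *: h b)); last by lin.
by apply: eq_tens_elim => c d; rewrite scalerA.
Qed.

Lemma lact_ract f g x : lact f (ract g x) = ract g (lact f x).
Proof.
by apply: functional_separate => h; rewrite -conv_lact -!conv_ract -conv_lact convA.
Qed.

Lemma lact_conv f g x : lact (conv f g) x = lact f (lact g x).
Proof. by apply: functional_separate => h; rewrite -!conv_lact convA. Qed.

Lemma ract_conv f g x : ract (conv f g) x = ract g (ract f x).
Proof. by apply: functional_separate => h; rewrite -!conv_ract convA. Qed.

Definition eps : dual C := counit.

Lemma lact_eps x : lact eps x = x.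
Proof. by rewrite lactE; apply: counitr. Qed.

Lemma ract_eps x : ract eps x = x.
Proof. by rewrite ractE; apply: counitl. Qed.

Lemma eps_lact f x : eps (lact f x) = f x.
Proof. by rewrite -conv_lact conv_ract ract_eps. Qed.

Lemma eps_ract f x : eps (ract f x) = f x.
Proof. by rewrite -conv_ract conv_lact lact_eps. Qed.

Lemma lactB f g x : lact (f - g) x = lact f x - lact g x.
Proof.
apply: functional_separate => h.
rewrite -conv_lact conv_ract add_lfunE opp_lfunE -!conv_ract !conv_lact.
by rewrite -linearB.
Qed.

Lemma ractB f g x : ract (f - g) x = ract f x - ract g x.
Proof.
apply: functional_separate => h.
rewrite -conv_ract conv_lact add_lfunE opp_lfunE -!conv_lact !conv_ract.
by rewrite -linearB.
Qed.

Lemma lact_fun_linear x : linear (fun f : dual C => lact f x).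
Proof.
move=> a f g; apply: functional_separate => h.
by rewrite linearP /= -!conv_lact !conv_ract add_lfunE scale_lfunE.
Qed.

Lemma ract_fun_linear x : linear (fun f : dual C => ract f x).
Proof.
move=> a f g; apply: functional_separate => h.
by rewrite linearP /= -!conv_ract !conv_lact add_lfunE scale_lfunE.
Qed.

(** Subcoalgebras are the sub-bimodules over the dual algebra: a tensor lies in D ⊗ D as soon as all
    its slices lie in [D]. *)
Lemma subcoalgebraP D :
  subcoalgebra D <-> (forall x, x \in D -> forall f, lact f x \in D /\ ract f x \in D).
Proof.
split=> [sD x xD f|sD x xD].
  by rewrite lactE ractE (slicel_mem _ (sD _ xD)) (slicer_mem _ (sD _ xD)).
by apply: tensvP => f; rewrite -?lactE -?ractE; have [] := sD x xD f.
Qed.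

Lemma comul_separate x (t : tens C C) :
  (forall f g, conv f g x = tens_elim (fun a b => f a *: g b) t) -> comul x = t.
Proof. by move=> xt; apply: tens_separate => f g; rewrite -xt convE. Qed.

Local Notation C0 := (@coradical k C).
Local Notation rad f := (annihilates f C0).

Lemma subcoalgebra_add D E : subcoalgebra D -> subcoalgebra E -> subcoalgebra (D + E)%VS.
Proof.
move=> /subcoalgebraP sD /subcoalgebraP sE; apply/subcoalgebraP.
move=> _ /memv_addP[x xD [y yE ->]] f; rewrite !linearD.
by have [? ?] := sD x xD f; have [? ?] := sE y yE f; split; apply: memv_add.
Qed.

Lemma subcoalgebra_cap D E : subcoalgebra D -> subcoalgebra E -> subcoalgebra (D :&: E)%VS.
Proof.
move=> /subcoalgebraP sD /subcoalgebraP sE; apply/subcoalgebraP.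
move=> x /memv_capP[xD xE] f; have [? ?] := sD x xD f; have [? ?] := sE x xE f.
by split; apply/memv_capP.
Qed.

(** [sumv_pred] is only known as a least upper bound, so it is bounded by the preimages of the
    coradical under both actions, which contain every simple subcoalgebra. *)
Lemma coradical_subcoalgebra : subcoalgebra C0.
Proof.
apply/subcoalgebraP => x xC0 f; rewrite !memv_preim.
suff le : (C0 <= lact f @^-1: C0 :&: ract f @^-1: C0)%VS.
  by have := subvP le _ xC0; rewrite memv_cap => /andP.
apply: sumv_pred_min => D sD; have DC0 := sumv_pred_sup sD.
apply/subvP => y yD; rewrite memv_cap -!memv_preim.
have [/subcoalgebraP/(_ y yD f)[? ?] _ _] := sD.
by rewrite !(subvP DC0).
Qed.

Lemma ract_rad f x : rad f -> x \in C0 -> ract f x = 0.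
Proof.
move=> fJ xC0; rewrite ractE; apply: slicel_eq0 (coradical_subcoalgebra xC0).
exact: fJ.
Qed.

Lemma lact_annihilates D f x : subcoalgebra D -> annihilates f D -> x \in D -> lact f x = 0.
Proof.
move=> /subcoalgebraP sD fD xD; apply: functional_separate => g.
by rewrite -conv_lact conv_ract fD ?linear0 //; have [] := sD x xD g.
Qed.

Lemma ract_annihilates D f x : subcoalgebra D -> annihilates f D -> x \in D -> ract f x = 0.
Proof.
move=> /subcoalgebraP sD fD xD; apply: functional_separate => g.
by rewrite -conv_ract conv_lact fD ?linear0 //; have [] := sD x xD g.
Qed.

Lemma ract_rad_eq0 x : (forall f, rad f -> ract f x = 0) -> x \in C0.
Proof.
by move=> xJ; apply: vspace_separate => f fJ; rewrite -eps_ract xJ // linear0.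
Qed.

Lemma lact_rad_eq0 x : (forall f, rad f -> lact f x = 0) -> x \in C0.
Proof.
by move=> xJ; apply: vspace_separate => f fJ; rewrite -eps_lact xJ // linear0.
Qed.

Lemma corad_ractP n x :
  x \in corad_filtration n.+1 <-> (forall f, rad f -> ract f x \in corad_filtration n).
Proof.
rewrite /= -memv_preim mem_tens_sum.
by split=> H f fJ; have := H f fJ; rewrite ractE.
Qed.

(** The recursive definition puts the coradical in the left leg and so favours [ract]. The other
    side follows by induction: the two actions commute, and the coradical consists of the elements
    killed by all radical functionals, from either side. *)
Lemma corad_lactP n x :
  x \in corad_filtration n.+1 <-> (forall f, rad f -> lact f x \in corad_filtration n).
Proof.
have sC0 := coradical_subcoalgebra.
elim: n x => [|n IH] x; rewrite corad_ractP; split=> H f fJ.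
- apply: ract_rad_eq0 => g gJ; rewrite -lact_ract.
  exact: lact_annihilates (H g gJ).
- apply: lact_rad_eq0 => g gJ; rewrite lact_ract.
  exact: ract_annihilates (H g gJ).
- apply/corad_ractP => g gJ; rewrite -lact_ract.
  exact: (proj1 (IH _) (H g gJ)).
- apply/IH => g gJ; rewrite lact_ract.
  exact: (proj1 (corad_ractP _ _) (H g gJ)).
Qed.

(** Stability under one action is read off from the characterisation by the other, because the two
    actions commute. *)
Lemma corad_subcoalgebra n : subcoalgebra (corad_filtration n : {vspace C}).
Proof.
elim: n => [|n /subcoalgebraP IH]; first exact: coradical_subcoalgebra.
apply/subcoalgebraP => x xn f; split.
  apply/corad_ractP => g gJ; rewrite -lact_ract.
  by have [] := IH _ (proj1 (corad_ractP _ _) xn g gJ) f.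
apply/corad_lactP => g gJ; rewrite lact_ract.
by have [] := IH _ (proj1 (corad_lactP _ _) xn g gJ) f.
Qed.

Lemma corad_lact n f x : x \in corad_filtration n -> lact f x \in corad_filtration n.
Proof. by move=> xn; have /subcoalgebraP/(_ x xn f)[] := @corad_subcoalgebra n. Qed.

Lemma corad_ract n f x : x \in corad_filtration n -> ract f x \in corad_filtration n.
Proof. by move=> xn; have /subcoalgebraP/(_ x xn f)[] := @corad_subcoalgebra n. Qed.

Lemma corad_mono m n : (m <= n)%N ->
  (corad_filtration m <= (corad_filtration n : {vspace C}))%VS.
Proof.
elim: n => [|n IH]; first by rewrite leqn0 => /eqP->.
rewrite leq_eqVlt => /predU1P[->//|/IH mn]; apply: subv_trans mn _.
by apply/subvP => x xn; apply/corad_ractP => f _; apply: corad_ract.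
Qed.

(** Phrased through images and preimages of subcoalgebras so as to cover coalgebra maps and
    anti-coalgebra maps at once. A simple D has simple image, since subcoalgebras of the image pull
    back into D; equality then follows by dimension. *)
Lemma coradical_image (T : 'End(C)) : lker T = 0%VS ->
  (forall D, subcoalgebra D -> subcoalgebra (T @: D)%VS) ->
  (forall D, subcoalgebra D -> subcoalgebra (T @^-1: D)%VS) ->
  (T @: C0)%VS = C0.
Proof.
move=> /eqP T0 Ti Tp.
have limT : limg T = {:C}%VS by rewrite lker0_limgf.
apply/eqP; rewrite eqEdim (limg_dim_eq (f := T)) ?leqnn ?andbT; last first.
  by rewrite (eqP T0) capv0.
suff : (C0 <= T @^-1: C0)%VS by move/(limgS T); rewrite lpreimK // limT subvf.
apply: sumv_pred_min => D [sD D0 Dmin].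
suff sTD : simple_subcoalgebra (T @: D)%VS.
  by apply/subvP => x xD; rewrite -memv_preim (subvP (sumv_pred_sup sTD)) // memv_img.
split; first exact: Ti.
  by move/eqP; rewrite -(limg0 T) (eq_limg_ker0 _ _ T0) => /eqP.
move=> E sE ED; have TE : (T @: (T @^-1: E))%VS = E by rewrite lpreimK // limT subvf.
have [||E0|ED'] := Dmin (T @^-1: E)%VS; first exact: Tp.
- by rewrite -(limg_ker0 _ _ T0) TE.
- by left; rewrite -TE E0 limg0.
by right; rewrite -TE ED'.
Qed.

End Coalgebra.

(** * Burnside's theorem and simple subquotients *)

Section Burnside.
Variable k : closedFieldType.

Lemma rank_subr_eigenvalue r (B : 'M[k]_r) : (0 < r)%N ->
  exists a, (\rank (B - a%:M)%R < r)%N.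
Proof.
move=> r_gt0; have /closed_rootP[a] : size (char_poly B) != 1%N.
  by rewrite size_char_poly eqSS -lt0n.
rewrite -eigenvalue_root_char => /eigenvalueP[v vB v0]; exists a.
rewrite ltnNge; apply: contra v0 => rk.
have free_Ba : row_free (B - a%:M) by rewrite /row_free eqn_leq rank_leq_row.
apply/eqP/(row_free_inj free_Ba).
by rewrite mul0mx mulmxBr vB mul_mx_scalar subrr.
Qed.

(* After Lomonosov and Rosenthal: a nonzero element T = L Q of R of minimal rank has rank one,
   because for X in R and an eigenvalue a of Q X L the rank of T X T - a T is smaller. *)
Lemma burnside n (R : {vspace 'M[k]_n}) :
  {in R &, forall X Y, X *m Y \in R} ->
  (forall v w : 'cV[k]_n, v != 0 -> exists2 X, X \in R & X *m v = w) ->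
  forall X, X \in R.
Proof.
case: n R => [R _ _ X|n R RM Rtr]; first by rewrite [X]flatmx0 mem0v.
pose P r := `[< exists T, [/\ T \in R, T != 0 & \rank T = r] >].
have exP : exists r, P r.
  have [|X XR Xv] := Rtr (delta_mx 0 0) (delta_mx 0 0).
    by apply/eqP => /matrixP/(_ 0 0)/eqP; rewrite !mxE eqxx oner_eq0.
  exists (\rank X); apply/asboolP; exists X; split=> //.
  apply/eqP => X0; have /matrixP/(_ 0 0)/eqP := Xv.
  by rewrite X0 mul0mx !mxE eqxx eq_sym oner_eq0.
have [r /asboolP[T [TR T0 rT]] rmin] := ex_minnP exP.
have [s [L [Q [Q' [L' [sT LQ QQ LL]]]]]] : exists s (L : 'M_(n.+1, s)) (Q : 'M_(s, n.+1))
    (Q' : 'M_(n.+1, s)) (L' : 'M_(s, n.+1)),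
    [/\ \rank T = s, L *m Q = T, Q *m Q' = 1%:M & L' *m L = 1%:M].
  exists (\rank T), (col_base T), (row_base T), (pinvmx (row_base T)), (pinvmx (col_base T)).
  by rewrite mulmx_base mulmxVp ?mulVpmx ?row_base_free ?col_base_full.
have rT0 : (0 < s)%N by rewrite -sT lt0n mxrank_eq0.
have scal X : X \in R -> exists a, Q *m X *m L = a%:M.
  move=> XR; have [a rka] := rank_subr_eigenvalue (Q *m X *m L) rT0.
  exists a; set B := Q *m X *m L in rka *.
  have E : L *m (B - a%:M) *m Q = T *m X *m T - a *: T.
    by rewrite mulmxBr mulmxBl mul_mx_scalar -scalemxAl LQ -LQ !mulmxA.
  have ER : L *m (B - a%:M) *m Q \in R by rewrite E memvB ?memvZ ?RM.
  have E0 : L *m (B - a%:M) *m Q = 0.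
    apply/eqP; apply: contraLR rka => n0; rewrite -leqNgt.
    apply: (@leq_trans r); first by rewrite -rT sT.
    apply: (@leq_trans (\rank (L *m (B - a%:M)%R *m Q))).
      by apply: rmin; apply/asboolP; exists (L *m (B - a%:M) *m Q).
    exact: leq_trans (mxrankM_maxl _ _) (mxrankM_maxr _ _).
  apply/eqP; rewrite -subr_eq0.
  suff -> : B - a%:M = L' *m (L *m (B - a%:M) *m Q) *m Q' by rewrite E0 mulmx0 mul0mx.
  by rewrite !mulmxA LL mul1mx -mulmxA QQ mulmx1.
(* In dimension at least two, transitivity of [R] would give X with Q X L e1 = e2, which is
   impossible for a scalar matrix. *)
have r1 : s = 1%N.
  apply/eqP; rewrite eqn_leq rT0 andbT leqNgt; apply/negP => r2.
  pose e1 : 'cV[k]_s := delta_mx (Ordinal rT0) 0.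
  pose e2 : 'cV[k]_s := delta_mx (Ordinal r2) 0.
  have [|X XR Xv] := Rtr (L *m e1) (Q' *m e2).
    apply/eqP => Le; have /matrixP/(_ (Ordinal rT0) 0)/eqP : e1 = 0.
      by rewrite -[e1]mul1mx -LL -mulmxA Le mulmx0.
    by rewrite !mxE !eqxx oner_eq0.
  have [a Qa] := scal X XR.
  have : Q *m X *m L *m e1 = e2 by rewrite -!mulmxA Xv mulmxA QQ mul1mx.
  rewrite Qa mul_scalar_mx => /matrixP/(_ (Ordinal r2) 0)/eqP.
  by rewrite !mxE !eqxx mulr0 eq_sym oner_eq0.
have [u [f Tuf]] : exists (u : 'cV[k]_n.+1) (f : 'rV[k]_n.+1), T = u *m f.
  rewrite -LQ; clear QQ LL LQ scal; move: L Q; rewrite r1 => L Q.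
  by exists L, Q.
have u0 : u != 0 by apply: contraNneq T0 => u0; rewrite Tuf u0 mul0mx.
have f0 : f != 0 by apply: contraNneq T0 => f0; rewrite Tuf f0 mulmx0.
(* A functional killing all rows f Y is a column x; if x is nonzero, transitivity moves it to a
   basis column at which f does not vanish. *)
have fY w : exists2 Y, Y \in R & f *m Y = w.
  have lf : linear (fun Y : 'M[k]_n.+1 => f *m Y) by move=> a x y; rewrite linearP.
  suff : w \in (lfun_of lf @: R)%VS.
    by case/memv_imgP => Y YR ->; exists Y; rewrite ?lfun_ofE.
  apply/negPn/negP => /separating_functional[g gR gw].
  pose x : 'cV[k]_n.+1 := \col_i g (delta_mx 0 i).
  have gE v : g v = (v *m x) 0 0 :> k.
    rewrite {1}[v]row_sum_delta linear_sum mxE; apply: eq_bigr => i _.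
    by rewrite linearZ !mxE.
  have x0 : x != 0.
    apply/eqP => x0; have /eqP := gw; rewrite gE x0 mulmx0 mxE eq_sym.
    by rewrite oner_eq0.
  have [i fi] : exists i, f 0 i != 0.
    apply: contrapT => fi; move/eqP: f0; apply; apply/rowP => i; rewrite mxE.
    by apply/eqP/negPn/negP => fi0; apply: fi; exists i.
  have [Y YR Yx] := Rtr x (delta_mx i 0) x0.
  have := gR _ (memv_img (lfun_of lf) YR); rewrite lfun_ofE gE -mulmxA Yx.
  move/eqP; rewrite mxE (bigD1 i) //= !mxE !eqxx mulr1 big1 ?addr0 ?(negPf fi) // => j ji.
  by rewrite !mxE (negPf ji) mulr0.
move=> X; rewrite [X]matrix_sum_delta; apply: memv_suml => i _; apply: memv_suml => j _.
apply: memvZ; have [A AR Au] := Rtr u (delta_mx i 0) u0; have [B BR fB] := fY (delta_mx 0 j).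
have -> : delta_mx i j = A *m T *m B.
  by rewrite Tuf !mulmxA Au -mulmxA fB mul_delta_mx.
by rewrite !RM.
Qed.

End Burnside.

Section SimpleComodules.
Variables (k : closedFieldType) (C : coalgType k).
Implicit Types (f g h : dual C) (x y : C) (D U : {vspace C}).

(* The functionals chi express the linear independence of the c i j. *)
Definition comatrix d (c : 'I_d -> 'I_d -> C) : Prop :=
  [/\ forall f g i j, conv f g (c i j) = \sum_l f (c i l) *: g (c l j),
      forall i j, eps C (c i j) = (i == j)%:R &
      exists chi : 'I_d -> 'I_d -> dual C,
        forall i j i' j', chi i j (c i' j') = ((i == i') && (j == j'))%:R].

Definition lact_stable U := forall f x, x \in U -> lact f x \in U.

(** A minimal stable subspace above [U'] gives a simple quotient for [lact], and the [c i j] are its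
    matrix coefficients in a basis u. By Burnside's theorem the dual algebra acts by all matrices;
    functionals acting as matrix units witness the independence of the coefficients. *)
Lemma simple_subquotient U' U : lact_stable U' -> lact_stable U ->
  (U' <= U)%VS -> U <> U' ->
  exists d (c : 'I_d -> 'I_d -> C) (u : 'I_d -> C),
    [/\ (0 < d)%N, comatrix c, forall j, u j \in U, forall j, u j \notin U' &
        forall f j, lact f (u j) - \sum_i f (c i j) *: u i \in U'].
Proof.
move=> sU' sU U'U neU.
pose P n := `[< exists W, [/\ lact_stable W, (U' <= W <= U)%VS, W <> U' & \dim W = n] >].
have exP : exists n, P n.
  by exists (\dim U); apply/asboolP; exists U; rewrite U'U subvv.
have [n /asboolP[V [sV /andP[U'V VU] neV dV]] Vmin] := ex_minnP exP.
pose W := (V :\: U')%VS; pose d := \dim W; pose u (j : 'I_d) := (vbasis W)`_j.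
pose p := addv_pi1 V U'.
have pW x : p x \in W by apply: memv_pi.
have VE : (V + U')%VS = V by apply/addv_idPl.
have p_sub x : x \in V -> x - p x \in U'.
  rewrite -{1}VE => /addv_pi1_pi2 {1}<-; rewrite -/p addrAC subrr add0r.
  exact: memv_pi2.
have WU' x : x \in W -> x \in U' -> x = 0.
  by move=> xW xU'; apply/eqP; rewrite -memv0 -(capv_diff V U') memv_cap xW.
have pU' x : x \in U' -> p x = 0.
  move=> xU'; apply: WU' => //; rewrite -[p x](subKr x); apply: memvB => //.
  exact/p_sub/(subvP U'V).
have pid x : x \in W -> p x = x.
  move=> xW; apply/eqP; rewrite eq_sym -subr_eq0; apply/eqP/WU'.
    by apply: memvB.
  exact/p_sub/(subvP (diffvSl V U')).
have la i : linear (fun x : C => (coord (vbasis W) i (p x) : k^o)) by lin.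
pose alpha i : dual C := lfun_of (la i).
have aE i x : alpha i x = coord (vbasis W) i (p x) by apply: lfun_ofE.
have pE x : p x = \sum_i alpha i x *: u i.
  by rewrite [LHS](coord_vbasis (pW x)); apply: eq_bigr => i _; rewrite aE.
have uW j : u j \in W by apply/vbasis_mem/mem_nth; rewrite size_tuple.
have uV j : u j \in V by apply: subvP (uW j); apply: diffvSl.
have au i j : alpha i (u j) = (i == j)%:R.
  by rewrite aE pid ?uW // coord_free ?(basis_free (vbasisP _)) // eq_sym.
have aU' i x : x \in U' -> alpha i x = 0 by move=> xU'; rewrite aE pU' ?linear0.
(* f(c i j) is the i-th coordinate of f acting on u_j modulo [U']. *)
pose c i j := ract (alpha i) (u j).
have fc f i j : f (c i j) = alpha i (lact f (u j)) by rewrite -conv_ract conv_lact.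
have luc f j : lact f (u j) - \sum_i f (c i j) *: u i \in U'.
  have -> : \sum_i f (c i j) *: u i = p (lact f (u j)).
    by rewrite pE; apply: eq_bigr => i _; rewrite fc.
  exact/p_sub/sV.
have cM f g i j : conv f g (c i j) = \sum_l f (c i l) *: g (c l j).
  rewrite fc lact_conv -[lact g _](subrK (\sum_l g (c l j) *: u l)).
  rewrite linearD linearD /= (aU' i (lact f _)) ?sU' ?add0r //.
  rewrite !linear_sum; apply: eq_bigr => l _; rewrite !linearZ /= -!fc.
  exact: mulrC.
have lM : linear (fun f : dual C => \matrix_(i, j) (f (c i j) : k)).
  by move=> a f g; apply/matrixP => i j; rewrite !mxE add_lfunE scale_lfunE.
have d0 : (0 < d)%N.
  rewrite lt0n dimv_eq0 diffv_eq0; apply/negP => VU'; apply: neV.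
  by apply/eqP; rewrite eqEsubv VU'.
have full := @burnside k d (limg (lfun_of lM)).
exists d, c, u; split=> //.
- split=> // [i j|].
    by rewrite fc lact_eps au.
  have chi i j : exists f : dual C, forall i' j', f (c i' j') = ((i == i') && (j == j'))%:R.
    have [|v w v0|/= f _] := memv_imgP (full _ _ (delta_mx i j)).
    - move=> _ _ /memv_imgP[f _ ->] /memv_imgP[g _ ->]; apply/memv_imgP.
      exists (conv f g); rewrite ?memvf // !lfun_ofE.
      by apply/matrixP => a b; rewrite !mxE cM; apply: eq_bigr => l _; rewrite !mxE.
    - pose x := \sum_j v j 0 *: u j.
      have xW : x \in W by apply: memv_suml => l _; apply: memvZ.
      have ax l : alpha l x = v l 0.
        rewrite linear_sum (bigD1 l) //= big1 ?addr0 => [|m ml].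
          by rewrite linearZ /= au eqxx; apply: mulr1.
        by rewrite linearZ /= au eq_sym (negPf ml); apply: mulr0.
      have xU' : x \notin U'.
        apply: contra v0 => xU'; apply/eqP/colP => l.
        by rewrite -ax (WU' x) // linear0 mxE.
      pose lx := lfun_of (lact_fun_linear x).
      have lxE f : lx f = lact f x by apply: lfun_ofE.
      have lME f : lfun_of lM f = \matrix_(i, j) (f (c i j) : k) by apply: lfun_ofE.
      (* The submodule generated by x together with [U']. It is strictly larger than [U'], so
         minimality gives X = V, which is the transitivity required by Burnside's theorem. *)
      pose X := (limg lx + U')%VS.
      have VX : X = V.
        apply/eqP; rewrite eqEdim dV Vmin ?andbT.
          rewrite subv_add U'V andbT; apply/subvP => _ /memv_imgP[f _ ->].
          by rewrite lxE sV // (subvP (diffvSl V U')).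
        apply/asboolP; exists X; split=> //.
        + move=> f y /memv_addP[_ /memv_imgP[g _ ->] [z zU' ->]].
          rewrite linearD memv_add ?sU' //; apply/memv_imgP; exists (conv f g).
            exact: memvf.
          by rewrite !lxE lact_conv.
        + rewrite addvSr subv_add (subv_trans U'V VU) andbT; apply/subvP.
          move=> _ /memv_imgP[f _ ->]; rewrite lxE (subvP VU) // sV //.
          by rewrite (subvP (diffvSl V U')).
        move=> XU'; move/negP: xU'; apply; rewrite -XU'.
        rewrite -[x]addr0 memv_add ?mem0v //; apply/memv_imgP.
        by exists (eps C); rewrite ?memvf // lxE lact_eps.
      have : \sum_j w j 0 *: u j \in X.
        by rewrite VX; apply: memv_suml => l _; apply: memvZ.
      case/memv_addP => _ /memv_imgP[f _ ->] [z zU' wE].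
      exists (lfun_of lM f); first by rewrite memv_img ?memvf.
      apply/colP => l; have := congr1 (alpha l) wE.
      rewrite linearD /= (aU' _ z) // addr0 lME lxE [LHS]linear_sum (bigD1 l) //=.
      rewrite big1 ?addr0 => [|m ml]; last by rewrite linearZ /= au eq_sym (negPf ml); apply: mulr0.
      rewrite linearZ /= au eqxx => wl; rewrite -[w l 0]mulr1 [RHS]wl /x.
      rewrite !linear_sum mxE; apply: eq_bigr => m _.
      by rewrite !linearZ /= -fc mxE /GRing.scale /= mulrC.
    rewrite lfun_ofE => /matrixP fE; exists f => i' j'.
    by have := fE i' j'; rewrite !mxE => <-; rewrite [i' == _]eq_sym [j' == _]eq_sym.
  by exists (fun i j => sval (cid (chi i j))) => i j; case: cid.
- by move=> j; apply: subvP (uV j).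
move=> j; apply/negP => uU'; have := au j j.
by rewrite aU' // eqxx => /eqP; rewrite eq_sym oner_eq0.
Qed.

End SimpleComodules.

Section ComatrixSpan.
Variables (k : closedFieldType) (C : coalgType k).
Implicit Types (f g h : dual C) (x y : C) (D U : {vspace C}).

Definition mxcomb d1 d2 (c : 'I_d1 -> 'I_d2 -> C) (M : 'M[k]_(d1, d2)) : C :=
  \sum_i \sum_j M i j *: c i j.

Lemma mxcomb_linear d1 d2 (c : 'I_d1 -> 'I_d2 -> C) : linear (mxcomb c).
Proof.
move=> a A B; rewrite scaler_sumr -big_split; apply: eq_bigr => i _ /=.
rewrite scaler_sumr -big_split; apply: eq_bigr => j _ /=.
by rewrite !mxE scalerDl scalerA.
Qed.

Definition mxspan d1 d2 (c : 'I_d1 -> 'I_d2 -> C) : {vspace C} :=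
  limg (lfun_of (mxcomb_linear c)).

Lemma mxspanP d1 d2 (c : 'I_d1 -> 'I_d2 -> C) x :
  reflect (exists M, x = mxcomb c M) (x \in mxspan c).
Proof.
apply: (iffP memv_imgP) => [[M _ ->]|[M ->]]; exists M; rewrite ?memvf //.
  exact: lfun_ofE.
by rewrite lfun_ofE.
Qed.

Lemma mxcomb_mem U d1 d2 (c : 'I_d1 -> 'I_d2 -> C) M :
  (forall i j, c i j \in U) -> mxcomb c M \in U.
Proof.
by move=> cU; apply: memv_suml => i _; apply: memv_suml => j _; apply/memvZ/cU.
Qed.

Lemma mxspan_sub U d1 d2 (c : 'I_d1 -> 'I_d2 -> C) :
  (forall i j, c i j \in U) -> (mxspan c <= U)%VS.
Proof. by move=> cU; apply/subvP => _ /mxspanP[M ->]; apply: mxcomb_mem. Qed.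

Lemma mem_mxspan d1 d2 (c : 'I_d1 -> 'I_d2 -> C) i j : c i j \in mxspan c.
Proof.
apply/mxspanP; exists (delta_mx i j); rewrite /mxcomb (bigD1 i) //= (bigD1 j) //= mxE !eqxx.
rewrite scale1r !big1 ?addr0 // => [i' i'i|j' j'j].
  by rewrite big1 // => j' _; rewrite mxE (negPf i'i) scale0r.
by rewrite mxE (negPf j'j) andbF scale0r.
Qed.

Lemma lfun_mxcomb (W : vectType k) (T : 'Hom(C, W)) d1 d2 (c : 'I_d1 -> 'I_d2 -> C) M :
  T (mxcomb c M) = \sum_i \sum_j M i j *: T (c i j).
Proof.
rewrite linear_sum; apply: eq_bigr => i _; rewrite linear_sum.
by apply: eq_bigr => j _; rewrite linearZ.
Qed.

Variables (d : nat) (c : 'I_d -> 'I_d -> C).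
Hypothesis cc : comatrix c.

Lemma comatrix_lact f i j : lact f (c i j) = \sum_l f (c l j) *: c i l.
Proof.
have [cM _ _] := cc; apply: functional_separate => h.
rewrite -conv_lact cM linear_sum; apply: eq_bigr => l _.
by rewrite linearZ; apply: mulrC.
Qed.

Lemma comatrix_ract f i j : ract f (c i j) = \sum_l f (c i l) *: c l j.
Proof.
have [cM _ _] := cc; apply: functional_separate => h.
by rewrite -conv_ract cM linear_sum; apply: eq_bigr => l _; rewrite linearZ.
Qed.

Lemma comatrix_comul i j : comul (c i j) = \sum_l c i l ⊗ c l j.
Proof.
have [cM _ _] := cc; apply: comul_separate => f g; rewrite cM.
rewrite (linear_sum_fun _ _ _ (@tens_elim_linear _ _ _ _ _)).
by apply: eq_bigr => l _; rewrite tens_elimE //; lin.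
Qed.

Lemma mxspan_subcoalgebra : subcoalgebra (mxspan c).
Proof.
apply/subcoalgebraP => _ /mxspanP[M ->] f; rewrite !lfun_mxcomb.
split; apply: memv_suml => i _; apply: memv_suml => j _; apply: memvZ.
  by rewrite comatrix_lact; apply: memv_suml => l _; apply/memvZ/mem_mxspan.
by rewrite comatrix_ract; apply: memv_suml => l _; apply/memvZ/mem_mxspan.
Qed.

Lemma sum_delta n (W : lmodType k) (F : 'I_n -> W) i :
  \sum_j (j == i)%:R *: F j = F i.
Proof.
rewrite (bigD1 i) //= eqxx scale1r big1 ?addr0 // => j ji.
by rewrite (negPf ji) scale0r.
Qed.

(** The functionals [chi] act as matrix units: [chi i0 a] on the left leg and [chi b j0] on the
    right leg turn the combination with matrix M into [M i0 j0 *: c a b]. One nonzero element of [E]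
    thus produces all the [c a b]. *)
Lemma comatrix_simple : (0 < d)%N -> simple_subcoalgebra (mxspan c).
Proof.
move=> d0; have [cM ce [chi chiE]] := cc; split; first exact: mxspan_subcoalgebra.
  move=> c0; have := mem_mxspan c (Ordinal d0) (Ordinal d0).
  rewrite c0 memv0 => /eqP c00; have := ce (Ordinal d0) (Ordinal d0).
  by rewrite c00 linear0 eqxx => /eqP; rewrite eq_sym oner_eq0.
move=> E /subcoalgebraP sE Ec; have [->|E0] := eqVneq E 0%VS; first by left.
right; apply/eqP; rewrite eqEsubv Ec /=.
have xE := memv_pick E; have x0 : vpick E != 0 by rewrite vpick0.
have /mxspanP[M ME] := subvP Ec _ xE.
have [i0 [j0 Mij]] : exists i j, M i j != 0.
  apply: contrapT => M0; move/eqP: x0; apply; rewrite ME /mxcomb big1 // => i _.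
  rewrite big1 // => j _; have [->|Mij] := eqVneq (M i j) 0; first by rewrite scale0r.
  by case: M0; exists i, j.
apply: mxspan_sub => a b.
have cl i j : lact (chi b j0) (c i j) = (j == j0)%:R *: c i b.
  rewrite comatrix_lact; under eq_bigr => l _ do rewrite chiE [b == l]eq_sym.
  have [_|_] := eqVneq j j0.
    by under eq_bigr => l _ do rewrite andbT; rewrite sum_delta scale1r.
  by rewrite big1 ?scale0r // => l _; rewrite andbF scale0r.
have cr i j : ract (chi i0 a) (c i j) = (i == i0)%:R *: c a j.
  rewrite comatrix_ract; under eq_bigr => l _ do rewrite chiE [a == l]eq_sym.
  have [_|_] := eqVneq i i0; first by rewrite sum_delta scale1r.
  by rewrite big1 ?scale0r // => l _; rewrite scale0r.
have : (M i0 j0)^-1 *: ract (chi i0 a) (lact (chi b j0) (vpick E)) \in E.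
  by apply: memvZ; have [/sE/(_ (chi i0 a))[]] := sE _ xE (chi b j0).
rewrite ME lfun_mxcomb linear_sum.
under eq_bigr => i _ do rewrite linear_sum.
under eq_bigr => i _ do under eq_bigr => j _ do rewrite cl scalerA mulrC -scalerA linearZ linearZ /= cr.
under eq_bigr => i _ do rewrite sum_delta scalerA mulrC -scalerA.
by rewrite sum_delta scalerA mulVf // scale1r.
Qed.

Lemma comatrix_degree : degree (mxspan c) d.
Proof.
have [cM ce [chi chiE]] := cc.
rewrite /degree /mxspan limg_dim_eq ?dimvf ?dim_matrix ?mulnn //.
apply/eqP; rewrite capfv -subv0; apply/subvP => M.
rewrite memv_ker lfun_ofE memv0 => /eqP M0; apply/eqP/matrixP => i j.
have := congr1 (chi i j) M0; rewrite linear0 lfun_mxcomb mxE => <-.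
rewrite (bigD1 i) //= (bigD1 j) //= chiE !eqxx big1 ?big1 ?addr0.
- by rewrite [RHS]mulr1.
- move=> i' i'i; apply: big1 => j' _; rewrite chiE eq_sym (negPf i'i); exact: mulr0.
- by move=> j' j'j; rewrite chiE eqxx eq_sym (negPf j'j); apply: mulr0.
Qed.

Lemma comatrix_coradical : (0 < d)%N -> (mxspan c <= coradical)%VS.
Proof. by move=> d0; apply/sumv_pred_sup/comatrix_simple. Qed.

End ComatrixSpan.

Lemma comatrix_group_like (k : closedFieldType) (C : coalgType k) (a : C) :
  group_like a -> comatrix (fun _ _ : 'I_1 => a).
Proof.
move=> [ga ea]; split=> [f g i j|i j|]; rewrite ?(ord1 i) ?(ord1 j) ?eqxx.
- by rewrite big_ord1 convE ga tens_elimE //; lin.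
- exact: ea.
exists (fun _ _ => eps C) => i j i' j'.
by rewrite (ord1 i) (ord1 j) (ord1 i') (ord1 j') eqxx.
Qed.

Lemma annihilates_mxspan (k : closedFieldType) (C : coalgType k) d1 d2
    (c : 'I_d1 -> 'I_d2 -> C) (f : dual C) :
  annihilates f (mxspan c) <-> (forall i j, f (c i j) = 0).
Proof.
split=> [fc i j|fc _ /mxspanP[M ->]]; first exact/fc/mem_mxspan.
rewrite lfun_mxcomb big1 // => i _; rewrite big1 // => j _.
by rewrite fc scaler0.
Qed.

(** * The coradical filtration exhausts the coalgebra *)

Section Exhaustion.
Variables (k : closedFieldType) (C : coalgType k).
Implicit Types (f : dual C) (x : C).
Local Notation Cn n := (corad_filtration n : {vspace C}).

(** A simple subquotient of C / C_n has its coefficients in the coradical, where radical functionals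
    vanish, so its basis vectors u_j lie in C_(n+1) but not in C_n. *)
Lemma corad_strict n : Cn n <> {:C}%VS -> (\dim (Cn n) < \dim (Cn n.+1))%N.
Proof.
move=> nfull.
have [||||d [c [u [d0 cc _ uC ul]]]] := @simple_subquotient k C (Cn n) {:C}%VS.
- by move=> f x; apply: corad_lact.
- by move=> *; apply: memvf.
- exact: subvf.
- by move/esym.
have uS : u (Ordinal d0) \in Cn n.+1.
  apply/corad_lactP => f fJ; rewrite -[lact f _](subrK (\sum_i f (c i (Ordinal d0)) *: u i)).
  rewrite memvD ?ul // big1 ?mem0v // => i _.
  rewrite (fJ (c i (Ordinal d0))) ?scale0r //.
  exact: subvP (comatrix_coradical cc d0) _ (mem_mxspan _ _ _).
rewrite ltn_neqAle (dimvS (corad_mono C (leqnSn n))) andbT; apply/negP => /eqP dE.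
have /eqP E : Cn n == Cn n.+1 by rewrite eqEdim corad_mono // -dE leqnn.
by move/negP: (uC (Ordinal d0)); apply; rewrite E.
Qed.

Lemma corad_exhaustive : exists n, Cn n = {:C}%VS.
Proof.
apply: contrapT => nfull; have nf n : Cn n <> {:C}%VS by move=> E; apply: nfull; exists n.
have dn n : (n <= \dim (Cn n))%N.
  by elim: n => // n IH; apply: leq_ltn_trans IH (corad_strict (nf n)).
have := leq_trans (dn (\dim {:C}).+1) (dimvS (subvf _)).
by rewrite ltnn.
Qed.

Lemma corad_level x : x \notin coradical -> exists n, x \in Cn n.+1 /\ x \notin Cn n.
Proof.
move=> x0; have ex : exists n, x \in Cn n by have [n E] := corad_exhaustive; exists n; rewrite E memvf.
have [[|n] xn nmin] := ex_minnP ex; first by rewrite xn in x0.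
by exists n; split=> //; apply/negP => /nmin; rewrite ltnn.
Qed.

End Exhaustion.

(** * Components of a block system *)

Section BlockComponents.
Variables (k : closedFieldType) (C : coalgType k) (pi : 'End(C)) (Q : nat -> {vspace C}).
Implicit Types (f g h : dual C) (x y : C) (D U : {vspace C}).
Hypothesis piP : coradical_projection pi.
Hypothesis QP : block_complements pi Q.
Local Notation C0 := (@coradical k C).
Local Notation Cn n := (corad_filtration n : {vspace C}).

(** This splits the dual algebra into a copy of the dual of the coradical and the radical: [toC0] is
    multiplicative because [pi] is a coalgebra map, and f - [toC0 f] kills the coradical. Acting
    through [toC0 f] amounts to slicing [rhoL] or [rhoR] by f. *)
Definition toC0 f : dual C := (f \o pi)%VF.

Lemma toC0E f x : toC0 f x = f (pi x).
Proof. exact: comp_lfunE. Qed.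

Lemma pi_coradical x : pi x \in C0.
Proof. by have [<- _ _ _] := piP; apply: memv_img; apply: memvf. Qed.

Lemma pi_id x : x \in C0 -> pi x = x.
Proof. by have [_ piid _ _] := piP; apply: piid. Qed.

Lemma toC0_eps : toC0 (eps C) = eps C.
Proof. by have [_ _ _ pie] := piP; apply/lfunP => x; rewrite toC0E; apply: pie. Qed.

Lemma toC0_conv f g : conv (toC0 f) (toC0 g) = toC0 (conv f g).
Proof.
have [_ _ pim _] := piP; apply/lfunP => x; rewrite toC0E !convE pim tens_elim_map; last by lin.
by apply: eq_tens_elim => a b; rewrite !toC0E.
Qed.

Lemma toC0_sub_rad f : annihilates (f - toC0 f) C0.
Proof. by move=> x xC0; rewrite add_lfunE opp_lfunE toC0E pi_id // subrr. Qed.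

Lemma slicel_rhoL f x : slicel f (rhoL pi x) = ract (toC0 f) x.
Proof.
rewrite ractE /slicel tens_elim_map; last by lin.
by apply: eq_tens_elim => a b; rewrite toC0E.
Qed.

Lemma slicer_rhoL f x : slicer f (rhoL pi x) = pi (lact f x).
Proof.
rewrite lactE /slicer tens_elim_map ?tens_elim_lin; try by lin.
by apply: eq_tens_elim => a b; rewrite linearZ.
Qed.

Lemma slicel_rhoR f x : slicel f (rhoR pi x) = pi (ract f x).
Proof.
rewrite ractE /slicel tens_elim_map ?tens_elim_lin; try by lin.
by apply: eq_tens_elim => a b; rewrite linearZ.
Qed.

Lemma slicer_rhoR f x : slicer f (rhoR pi x) = lact (toC0 f) x.
Proof.
rewrite lactE /slicer tens_elim_map; last by lin.
by apply: eq_tens_elim => a b; rewrite toC0E.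
Qed.

(** One leg of [rhoL] and of [rhoR] consists of values of [pi], which lie in the coradical, so the
    slices in the other leg carry the whole condition. *)
Lemma subbicomoduleP N : subbicomodule pi N <->
  (forall f x, x \in N -> ract (toC0 f) x \in N /\ lact (toC0 f) x \in N).
Proof.
split=> [sN f x /sN[xl xr]|sN x xN].
  by rewrite -slicel_rhoL -slicer_rhoR (slicel_mem _ xl) (slicer_mem _ xr).
split; apply: tensvP => f.
- by rewrite slicel_rhoL; have [] := sN f x xN.
- by rewrite slicer_rhoL pi_coradical.
- by rewrite slicel_rhoR pi_coradical.
by rewrite slicer_rhoR; have [] := sN f x xN.
Qed.

Lemma Q_sub n : (Q n.+1 <= filtration_part pi n.+1)%VS.
Proof. by have [_ <- _] := QP n; apply: addvSr. Qed.

Lemma Q_cap n x : x \in Q n.+1 -> x \in Cn n -> x = 0.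
Proof.
move=> xQ xn; have [_ _ Q0] := QP n; apply/eqP; rewrite -memv0 -Q0 memv_cap xQ andbT.
have := subvP (Q_sub n) _ xQ; rewrite !memv_cap => /andP[_ ->].
by rewrite xn.
Qed.

(** Elementwise form of the isomorphism from [Q n.+1] to C_(n+1) / C_n: subtracting [pi x] moves x
    into P_(n+1), and q is its component in [Q n.+1], congruent to x modulo C_n. What holds for x
    modulo C_n holds exactly for q, since [Q n.+1] is a subbicomodule meeting C_n in 0. *)
Lemma Q_component n x d1 d2 (c1 : 'I_d1 -> 'I_d1 -> C) (c2 : 'I_d2 -> 'I_d2 -> C) :
  (0 < d1)%N -> (0 < d2)%N -> comatrix c1 -> comatrix c2 ->
  x \in Cn n.+1 -> x \notin Cn n ->
  (forall f, annihilates f (mxspan c1) -> ract f x \in Cn n) ->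
  (forall f, annihilates f (mxspan c2) -> lact f x \in Cn n) ->
  exists q, [/\ q \in Q n.+1, q != 0,
    forall f, annihilates f (mxspan c1) -> ract (toC0 f) q = 0 &
    forall f, annihilates f (mxspan c2) -> lact (toC0 f) q = 0].
Proof.
move=> d10 d20 cc1 cc2 xn1 xn xl xr; have [sQ QE _] := QP n.
have C0n m : (C0 <= Cn m)%VS by apply: (@corad_mono _ _ 0).
have pix m : pi x \in Cn m by apply: subvP (C0n m) _ (pi_coradical x).
have : x - pi x \in filtration_part pi n.+1.
  apply/memv_capP; split; first exact: memvB.
  by rewrite memv_ker linearB /= (pi_id (pi_coradical x)) subrr.
rewrite -QE => /memv_addP[p pP [q qQ xE]].
pose y := pi x + p; have xyq : x = y + q by rewrite /y -addrA -xE addrC subrK.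
have yn : y \in Cn n.
  apply: memvD => //.
  by move: pP; rewrite memv_cap => /andP[].
have qE : q = x - y by rewrite xyq addrAC subrr add0r.
have anl f d (c : 'I_d -> 'I_d -> C) : (0 < d)%N -> comatrix c ->
  annihilates f (mxspan c) -> annihilates (toC0 f) (mxspan c).
  move=> d0 cc fc a ac; rewrite toC0E pi_id ?fc //.
  exact: subvP (comatrix_coradical cc d0) _ ac.
exists q; split=> // [|f fc|f fc].
- by apply: contraNneq xn => q0; rewrite xyq q0 addr0.
- apply: (@Q_cap n); first by have [] := proj1 (subbicomoduleP _) sQ f q qQ.
  rewrite qE linearB; apply: memvB; last exact: corad_ract.
  by apply: xl; apply: anl fc.
- apply: (@Q_cap n); first by have [] := proj1 (subbicomoduleP _) sQ f q qQ.
  rewrite qE linearB; apply: memvB; last exact: corad_lact.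
  by apply: xr; apply: anl fc.
Qed.

(* A level-one component between one-dimensional coalgebras consists of skew-primitives, because
   Delta q = rhoL q + rhoR q for q in the kernel of pi at level one. *)
Lemma skew_primitive_component x (c1 c2 : 'I_1 -> 'I_1 -> C) :
  no_nontrivial_skew_primitives C ->
  comatrix c1 -> comatrix c2 ->
  x \in Cn 1 ->
  (forall f, annihilates f (mxspan c1) -> ract f x \in C0) ->
  (forall f, annihilates f (mxspan c2) -> lact f x \in C0) ->
  x \in C0.
Proof.
move=> skew cc1 cc2 x1 xl xr; apply/negPn/negP => x0.
have [q [qQ q0 ql qr]] := Q_component (n := 0) (d1 := 1) (d2 := 1) isT isT cc1 cc2 x1 x0 xl xr.
pose g := c1 0 0; pose h := c2 0 0.
have grp (c : 'I_1 -> 'I_1 -> C) : comatrix c -> group_like (c 0 0).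
  move=> cc; have [_ ce _] := cc; split; first by rewrite (comatrix_comul cc) big_ord1.
  by have := ce 0 0; rewrite eqxx.
have mem1 (c : 'I_1 -> 'I_1 -> C) a : a \in mxspan c -> exists b, a = b *: c 0 0.
  by move=> /mxspanP[M ->]; exists (M 0 0); rewrite /mxcomb !big_ord1.
have an (c : 'I_1 -> 'I_1 -> C) f : comatrix c ->
    annihilates (f - f (c 0 0) *: eps C) (mxspan c).
  move=> cc _ /mem1[b ->]; have [_ ce _] := cc.
  rewrite linearZ /= add_lfunE opp_lfunE scale_lfunE ce eqxx.
  by rewrite [_ *: 1]mulr1 subrr scaler0.
have toC0_an (c : 'I_1 -> 'I_1 -> C) f :
    toC0 (f - f (c 0 0) *: eps C) = toC0 f - f (c 0 0) *: eps C.
  by apply/lfunP => z; rewrite toC0E !add_lfunE !opp_lfunE !scale_lfunE toC0E -[in RHS]toC0_eps toC0E.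
have lactZ f a z : lact (a *: f) z = a *: lact f z.
  by have := linearZ_fun a f (@lact_fun_linear k C z).
have ractZ f a z : ract (a *: f) z = a *: ract f z.
  apply: functional_separate => u; rewrite -conv_ract conv_lact scale_lfunE.
  by rewrite -conv_lact conv_ract linearZ.
have rq f : ract (toC0 f) q = f g *: q.
  apply/eqP; rewrite -subr_eq0; apply/eqP; have := ql _ (an c1 f cc1).
  by rewrite toC0_an ractB ractZ ract_eps.
have lq f : lact (toC0 f) q = f h *: q.
  apply/eqP; rewrite -subr_eq0; apply/eqP; have := qr _ (an c2 f cc2).
  by rewrite toC0_an lactB lactZ lact_eps.
have qP := subvP (Q_sub 0) _ qQ.
have q1 : q \in Cn 1 by move: qP; rewrite memv_cap => /andP[].
have piq : pi q = 0 by move: qP; rewrite memv_cap memv_ker => /andP[_ /eqP].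
have q_grp : q \in group_like_span C.
  apply: (skew q h g); [exact: grp|exact: grp|].
  apply: comul_separate => f e.
  rewrite (linearD_fun _ _ (@tens_elim_linear _ _ _ _ _)) !tens_elimE; try by lin.
  (* f' and e' vanish on the coradical, so their convolution vanishes on C_1. Of the remaining
     terms, the product of the two projected functionals is a value at [pi q] = 0, and the other two
     give the skew-primitive formula. *)
  pose f' := f - toC0 f; pose e' := e - toC0 e.
  have fe : conv f e q = conv f' e' q + conv (toC0 f) e q + conv f (toC0 e) q
      - conv (toC0 f) (toC0 e) q.
    have eE : lact e q = lact e' q + lact (toC0 e) q by rewrite lactB subrK.
    rewrite !conv_lact eE !linearD /= add_lfunE opp_lfunE.
    by rewrite addrA subrK addrAC addrK.
  rewrite fe.
  have -> : conv f' e' q = 0.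
    rewrite conv_lact; apply: toC0_sub_rad.
    by have /corad_lactP/(_ e' (toC0_sub_rad e)) := q1.
  have -> : conv (toC0 f) (toC0 e) q = 0 by rewrite toC0_conv toC0E piq linear0.
  rewrite add0r subr0 conv_ract rq conv_lact lq !linearZ /= addrC; congr (_ + _).
  exact: mulrC.
have q00 : q = 0.
  apply: (Q_cap qQ); apply: subvP q_grp; apply: sumv_pred_min => _ [a [ga ea] ->].
  have cc := comatrix_group_like (conj ga ea).
  by rewrite -memvE; apply: subvP (comatrix_coradical cc isT) _ (mem_mxspan _ 0 0).
by rewrite q00 eqxx in q0.
Qed.
End BlockComponents.

(** * Simple comodules attached to a comatrix *)

Section BlockNonzero.
Variables (k : closedFieldType) (C : coalgType k) (pi : 'End(C)).
Implicit Types (f g h : dual C) (x y : C) (D U : {vspace C}).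
Hypothesis piP : coradical_projection pi.
Local Notation toC0 f := (toC0 pi f).

Lemma row_sum n (w : 'rV[k]_n) : w = \sum_j w 0 j *: delta_mx 0 j.
Proof. exact: row_sum_delta. Qed.

Section StandardComodules.
Variables (d : nat) (c : 'I_d -> 'I_d -> C).
Hypotheses (d0 : (0 < d)%N) (cc : comatrix c).

Lemma rV_neq0 : {:'rV[k]_d}%VS <> 0%VS.
Proof.
move=> E; have : delta_mx 0 (Ordinal d0) \in {:'rV[k]_d}%VS by apply: memvf.
by rewrite E memv0 => /eqP/rowP/(_ (Ordinal d0))/eqP; rewrite !mxE !eqxx oner_eq0.
Qed.

(** Blocks are defined through actual comodules W and V, so a comatrix is realised on row vectors:
    e_i goes to sum_j c i j ⊗ e_j here, and e_l to sum_a e_a ⊗ c a l on the other side. *)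
Definition left_coaction_fun (w : 'rV[k]_d) : tens C 'rV[k]_d :=
  \sum_i \sum_j w 0 i *: (c i j ⊗ delta_mx 0 j).

Definition right_coaction_fun (v : 'rV[k]_d) : tens 'rV[k]_d C :=
  \sum_l \sum_a v 0 l *: (delta_mx 0 a ⊗ c a l).

Lemma left_coaction_linear : linear left_coaction_fun.
Proof.
move=> b x y; rewrite scaler_sumr -big_split; apply: eq_bigr => i _ /=.
rewrite scaler_sumr -big_split; apply: eq_bigr => j _ /=.
by rewrite !mxE scalerDl scalerA.
Qed.

Lemma right_coaction_linear : linear right_coaction_fun.
Proof.
move=> b x y; rewrite scaler_sumr -big_split; apply: eq_bigr => i _ /=.
rewrite scaler_sumr -big_split; apply: eq_bigr => j _ /=.
by rewrite !mxE scalerDl scalerA.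
Qed.

Definition left_coaction : 'Hom('rV[k]_d, tens C 'rV[k]_d) := lfun_of left_coaction_linear.
Definition right_coaction : 'Hom('rV[k]_d, tens 'rV[k]_d C) := lfun_of right_coaction_linear.

Lemma left_coactionE w :
  left_coaction w = \sum_i \sum_j w 0 i *: (c i j ⊗ delta_mx 0 j).
Proof. exact: lfun_ofE. Qed.

Lemma right_coactionE v :
  right_coaction v = \sum_l \sum_a v 0 l *: (delta_mx 0 a ⊗ c a l).
Proof. exact: lfun_ofE. Qed.

Lemma linear_left_coaction (W : vectType k) (L : tens C 'rV[k]_d -> W) w : linear L ->
  L (left_coaction w) = \sum_i \sum_j w 0 i *: L (c i j ⊗ delta_mx 0 j).
Proof.
move=> lL; rewrite left_coactionE (linear_sum_fun _ _ _ lL); apply: eq_bigr => i _.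
by rewrite (linear_sum_fun _ _ _ lL); apply: eq_bigr => j _; rewrite (linearZ_fun _ _ lL).
Qed.

Lemma linear_right_coaction (W : vectType k) (L : tens 'rV[k]_d C -> W) v : linear L ->
  L (right_coaction v) = \sum_l \sum_a v 0 l *: L (delta_mx 0 a ⊗ c a l).
Proof.
move=> lL; rewrite right_coactionE (linear_sum_fun _ _ _ lL); apply: eq_bigr => i _.
by rewrite (linear_sum_fun _ _ _ lL); apply: eq_bigr => j _; rewrite (linearZ_fun _ _ lL).
Qed.

Lemma left_coaction_delta i : left_coaction (delta_mx 0 i) = \sum_j c i j ⊗ delta_mx 0 j.
Proof.
rewrite left_coactionE (bigD1 i) //= [X in _ + X]big1 ?addr0 => [|i' i'i].
  by apply: eq_bigr => j _; rewrite mxE !eqxx scale1r.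
by rewrite big1 // => j _; rewrite mxE (negPf i'i) andbF scale0r.
Qed.

Lemma right_coaction_delta l : right_coaction (delta_mx 0 l) = \sum_a delta_mx 0 a ⊗ c a l.
Proof.
rewrite right_coactionE (bigD1 l) //= [X in _ + X]big1 ?addr0 => [|i' i'i].
  by apply: eq_bigr => j _; rewrite mxE !eqxx scale1r.
by rewrite big1 // => j _; rewrite mxE (negPf i'i) andbF scale0r.
Qed.

(** If w has a nonzero coordinate w_p, slicing its coaction by [chi p q] gives w_p e_q, so a nonzero
    subcomodule contains the whole basis. *)
Lemma simple_left_coaction : simple_left_comodule (mxspan c) left_coaction.
Proof.
have [_ ce [chi chiE]] := cc.
split; [split| |].
- move=> w; rewrite left_coactionE; apply: memv_suml => i _; apply: memv_suml => j _.
  by apply/memvZ/tensor_mem; [apply: mem_mxspan | apply: memvf].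
- move=> w; rewrite /tens_map (linear_left_coaction (L := fun t => tens_assoc (tens_elim _ t))); last first.
    by rewrite /tens_assoc; lin.
  rewrite linear_left_coaction; last by lin.
  apply: eq_bigr => i _; rewrite -!scaler_sumr; congr (_ *: _).
  transitivity (\sum_m \sum_j c i m ⊗ (c m j ⊗ (delta_mx 0 j : 'rV[k]_d))).
    rewrite [RHS]exchange_big; apply: eq_bigr => j _.
    rewrite tens_elimE; last by lin.
    rewrite /tens_assoc tens_elimE; last by lin.
    rewrite (comatrix_comul cc) (linear_sum_fun _ _ _ (@tens_elim_linear _ _ _ _ _)).
    by apply: eq_bigr => m _; rewrite tens_elimE //; lin.
  apply: eq_bigr => m _; rewrite tens_elimE; last by lin.
  by rewrite left_coaction_delta tensor_sumr.
- move=> w; rewrite (linear_left_coaction (L := tens_elim _)); last by lin.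
  rewrite [RHS]row_sum; apply: eq_bigr => i _; rewrite -scaler_sumr; congr (_ *: _).
  rewrite (bigD1 i) //= tens_elimE; last by lin.
  have cij j : (counit (c i j) : k) = (i == j)%:R by apply: ce.
  rewrite cij eqxx scale1r big1 ?addr0 // => j ji.
  by rewrite tens_elimE; [rewrite cij eq_sym (negPf ji) scale0r|lin].
- exact: rV_neq0.
move=> A sA; have [->|A0] := eqVneq A 0%VS; first by left.
right; apply/eqP; rewrite eqEsubv subvf /=; apply/subvP => v _.
have wA := memv_pick A; set w := vpick A in wA; have w0 : w != 0 by rewrite vpick0.
have [p wp] : exists p, w 0 p != 0.
  apply: contrapT => np; move/eqP: w0; apply; apply/rowP => p; rewrite mxE.
  by apply/eqP/negPn/negP => wp; apply: np; exists p.
rewrite [v]row_sum; apply: memv_suml => q _; apply: memvZ.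
suff : (w 0 p)^-1 *: slicel (chi p q) (left_coaction w) = delta_mx 0 q.
  by move=> <-; apply: memvZ; apply: slicel_mem (sA w wA).
rewrite (linear_left_coaction _ (@slicel_linear _ _ _ _)) (bigD1 p) //= (bigD1 q) //=.
rewrite !slicel_tensor chiE !eqxx big1 => [|j jq]; last first.
  by rewrite slicel_tensor chiE eqxx eq_sym (negPf jq) scale0r scaler0.
rewrite big1 => [|i ip]; last first.
  by rewrite big1 // => j _; rewrite slicel_tensor chiE eq_sym (negPf ip) scale0r scaler0.
by rewrite !addr0 scale1r scalerA mulVf // scale1r.
Qed.

Lemma simple_right_coaction : simple_right_comodule (mxspan c) right_coaction.
Proof.
have [_ ce [chi chiE]] := cc.
split; [split| |].
- move=> w; rewrite right_coactionE; apply: memv_suml => i _; apply: memv_suml => j _.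
  by apply/memvZ/tensor_mem; [apply: memvf | apply: mem_mxspan].
- move=> w; rewrite /tens_map (linear_right_coaction (L := fun t => tens_assoc (tens_elim _ t))); last first.
    by rewrite /tens_assoc; lin.
  rewrite linear_right_coaction; last by lin.
  apply: eq_bigr => l _; rewrite -!scaler_sumr; congr (_ *: _).
  transitivity (\sum_m \sum_a (delta_mx 0 a : 'rV[k]_d) ⊗ (c a m ⊗ c m l)).
    apply: eq_bigr => m _.
    rewrite tens_elimE; last by lin.
    rewrite right_coaction_delta tensor_suml.
    rewrite /tens_assoc (linear_sum_fun _ _ _ (@tens_elim_linear _ _ _ _ _)).
    by apply: eq_bigr => a _; rewrite !tens_elimE //; lin.
  rewrite exchange_big; apply: eq_bigr => a _; rewrite tens_elimE; last by lin.
  by rewrite (comatrix_comul cc) tensor_sumr.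
- move=> w; rewrite (linear_right_coaction (L := tens_elim _)); last by lin.
  rewrite [RHS]row_sum; apply: eq_bigr => i _; rewrite -scaler_sumr; congr (_ *: _).
  rewrite (bigD1 i) //= tens_elimE; last by lin.
  have cij j : (counit (c j i) : k) = (j == i)%:R by apply: ce.
  rewrite cij eqxx scale1r big1 ?addr0 // => j ji.
  by rewrite tens_elimE; [rewrite cij (negPf ji) scale0r|lin].
- exact: rV_neq0.
move=> A sA; have [->|A0] := eqVneq A 0%VS; first by left.
right; apply/eqP; rewrite eqEsubv subvf /=; apply/subvP => v _.
have wA := memv_pick A; set w := vpick A in wA; have w0 : w != 0 by rewrite vpick0.
have [p wp] : exists p, w 0 p != 0.
  apply: contrapT => np; move/eqP: w0; apply; apply/rowP => p; rewrite mxE.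
  by apply/eqP/negPn/negP => wp; apply: np; exists p.
rewrite [v]row_sum; apply: memv_suml => q _; apply: memvZ.
suff : (w 0 p)^-1 *: slicer (chi q p) (right_coaction w) = delta_mx 0 q.
  by move=> <-; apply: memvZ; apply: slicer_mem (sA w wA).
rewrite (linear_right_coaction _ (@slicer_linear _ _ _ _)) (bigD1 p) //= (bigD1 q) //=.
rewrite !slicer_tensor chiE !eqxx big1 => [|j jq]; last first.
  by rewrite slicer_tensor chiE eq_sym (negPf jq) scale0r scaler0.
rewrite big1 => [|i ip]; last first.
  by rewrite big1 // => j _; rewrite slicer_tensor chiE [p == i]eq_sym (negPf ip) andbF scale0r scaler0.
by rewrite !addr0 scale1r scalerA mulVf // scale1r.
Qed.

End StandardComodules.
End BlockNonzero.

(** * Simple subbicomodules and a criterion for nonzero blocks *)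

Section BlockNonzeroTheorem.
Variables (k : closedFieldType) (C : coalgType k) (pi : 'End(C)).
Implicit Types (f g h : dual C) (x y : C) (D U : {vspace C}).
Hypothesis piP : coradical_projection pi.
Local Notation toC0 := (toC0 pi).

Lemma toC0_linear : linear toC0.
Proof. by move=> a f g; apply/lfunP => x; rewrite !(toC0E, add_lfunE, scale_lfunE). Qed.

Lemma lact_toC0_linear x : linear (fun f : dual C => lact (toC0 f) x).
Proof. by move=> a f g; rewrite toC0_linear lact_fun_linear. Qed.

Lemma ract_toC0_linear x : linear (fun f : dual C => ract (toC0 f) x).
Proof. by move=> a f g; rewrite toC0_linear ract_fun_linear. Qed.

(** Modulo the functionals that kill [mxspan c], the [chi i j] form the basis dual to the
    [c i j]. *)
Lemma dual_expansion d (c : 'I_d -> 'I_d -> C) (chi : 'I_d -> 'I_d -> dual C)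
    (L : dual C -> C) f :
  (forall i j i' j', chi i j (c i' j') = ((i == i') && (j == j'))%:R) ->
  linear L -> (forall f, annihilates f (mxspan c) -> L f = 0) ->
  L f = \sum_i \sum_j f (c i j) *: L (chi i j).
Proof.
move=> chiE lL L0; apply/eqP; rewrite -subr_eq0.
pose F := \sum_i \sum_j f (c i j) *: chi i j.
have FE : L F = \sum_i \sum_j f (c i j) *: L (chi i j).
  rewrite (linear_sum_fun _ _ _ lL); apply: eq_bigr => i _.
  by rewrite (linear_sum_fun _ _ _ lL); apply: eq_bigr => j _; rewrite (linearZ_fun _ _ lL).
rewrite -FE -(linearB_fun _ _ lL); apply/eqP/L0 => _ /mxspanP[M ->].
rewrite lfun_mxcomb big1 // => i _; rewrite big1 // => j _.
suff -> : (f - F) (c i j) = 0 by apply: mulr0.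
rewrite add_lfunE opp_lfunE sum_lfunE (bigD1 i) //= sum_lfunE (bigD1 j) //=.
rewrite scale_lfunE chiE !eqxx big1 => [|j' j'j]; last first.
  by rewrite scale_lfunE chiE (negPf j'j) andbF; apply: mulr0.
rewrite big1 => [|i' i'i]; last first.
  rewrite sum_lfunE big1 // => j' _; rewrite scale_lfunE chiE (negPf i'i); exact: mulr0.
by rewrite !addr0 [_ *: 1]mulr1 subrr.
Qed.

(** [tens] stores coordinates in the unspecified bases [vbasis]; these are the coordinates in the
    standard basis e_i ⊗ e_j. *)
Definition rV_coef d1 d2 (t : tens 'rV[k]_d1 'rV[k]_d2) : 'M[k]_(d1, d2) :=
  \matrix_(i, j)
    (tens_elim (fun (w : 'rV[k]_d1) (v : 'rV[k]_d2) => (w 0 i * v 0 j : k^o)) t : k).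

Lemma tens_elim_delta d1 d2 (X : vectType k) (G : 'rV[k]_d1 -> 'rV[k]_d2 -> X) t :
  bilinear_fun G ->
  tens_elim G t = \sum_i \sum_j rV_coef t i j *: G (delta_mx 0 i) (delta_mx 0 j).
Proof.
move=> [G1 G2]; transitivity (tens_elim (fun (w : 'rV[k]_d1) (v : 'rV[k]_d2) =>
    \sum_i \sum_j (w 0 i * v 0 j) *: G (delta_mx 0 i) (delta_mx 0 j)) t).
  apply: eq_tens_elim => w v; rewrite {1}[w]row_sum (linear_sum_fun _ _ _ (G1 v)).
  apply: eq_bigr => i _; rewrite (linearZ_fun _ _ (G1 v)) {1}[v]row_sum.
  rewrite (linear_sum_fun _ _ _ (G2 _)) scaler_sumr; apply: eq_bigr => j _.
  by rewrite (linearZ_fun _ _ (G2 _)) scalerA.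
rewrite tens_elim_sum; apply: eq_bigr => i _; rewrite tens_elim_sum; apply: eq_bigr => j _.
rewrite mxE (tens_elim_lin (L := fun a : k^o => a *: G (delta_mx 0 i) (delta_mx 0 j))) //.
by lin.
Qed.

Section Frame.
Variables (d1 d2 : nat) (c1 : 'I_d1 -> 'I_d1 -> C) (c2 : 'I_d2 -> 'I_d2 -> C).
Hypotheses (d10 : (0 < d1)%N) (d20 : (0 < d2)%N) (cc1 : comatrix c1) (cc2 : comatrix c2).

(* The two coactions on z i j are those on the basis vector w_i ⊗ v_j of the simple bicomodule
   attached to c1 and c2. *)
Definition frame (z : 'I_d1 -> 'I_d2 -> C) :=
  [/\ forall f i j, ract (toC0 f) (z i j) = \sum_a f (c1 i a) *: z a j,
      forall f i j, lact (toC0 f) (z i j) = \sum_b f (c2 b j) *: z i b &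
      exists i j, z i j != 0].

(** Matrix units applied to q: z i a arises by acting with [chi1 i0 i] on the left leg and
    [chi2 a b0] on the right leg, for fixed i0 and b0 that leave something nonzero. Such indices
    exist because eps expands in the [chi] and acts as the identity. *)
Lemma frame_of_component (N : {vspace C}) q : subbicomodule pi N -> q \in N -> q != 0 ->
  (forall f, annihilates f (mxspan c1) -> ract (toC0 f) q = 0) ->
  (forall f, annihilates f (mxspan c2) -> lact (toC0 f) q = 0) ->
  exists2 z, frame z & forall i j, z i j \in N.
Proof.
move=> /(subbicomoduleP piP) sN qN q0 ql qr.
have [cM1 ce1 [chi1 chi1E]] := cc1; have [cM2 ce2 [chi2 chi2E]] := cc2.
pose w i j := ract (toC0 (chi1 i j)) q.
have wE f i j : ract (toC0 f) (w i j) = \sum_a f (c1 j a) *: w i a.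
  rewrite /w -ract_conv toC0_conv // (dual_expansion _ chi1E (@ract_toC0_linear q) ql).
  rewrite (bigD1 i) //= [X in _ + X]big1 ?addr0 => [|i' i'i].
    apply: eq_bigr => a _; congr (_ *: _); rewrite cM1 (bigD1 j) //= chi1E !eqxx.
    rewrite big1 ?addr0; first exact: mul1r.
    by move=> b bj; rewrite chi1E eq_sym (negPf bj) andbF; apply: mul0r.
  rewrite big1 // => a _; rewrite cM1 big1 ?scale0r // => b _.
  by rewrite chi1E eq_sym (negPf i'i); apply: mul0r.
have [i0 [j0 w0]] : exists i j, w i j != 0.
  apply: contrapT => nw; move/eqP: q0; apply; rewrite -[q]ract_eps -(toC0_eps piP).
  rewrite (dual_expansion _ chi1E (@ract_toC0_linear q) ql) big1 // => i _.
  rewrite big1 // => j _; suff -> : ract (toC0 (chi1 i j)) q = 0 by rewrite scaler0.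
  by apply/eqP/negPn/negP => wij; apply: nw; exists i, j.
have wr i j f : annihilates f (mxspan c2) -> lact (toC0 f) (w i j) = 0.
  by move=> fc; rewrite /w lact_ract qr // linear0.
pose v i j a b := lact (toC0 (chi2 a b)) (w i j).
have vE f i j a b : lact (toC0 f) (v i j a b) = \sum_e f (c2 e a) *: v i j e b.
  rewrite /v -lact_conv toC0_conv //.
  rewrite (dual_expansion _ chi2E (@lact_toC0_linear _) (wr i j)) exchange_big /=.
  rewrite (bigD1 b) //= [X in _ + X]big1 ?addr0 => [|b' b'b].
    apply: eq_bigr => e _; congr (_ *: _); rewrite cM2 (bigD1 a) //= chi2E !eqxx.
    rewrite big1 ?addr0; first exact: mulr1.
    by move=> m ma; rewrite chi2E eq_sym (negPf ma); apply: mulr0.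
  rewrite big1 // => e _; rewrite cM2 big1 ?scale0r // => m _.
  by rewrite chi2E [b == b']eq_sym (negPf b'b) andbF; apply: mulr0.
have [a0 [b0 v0]] : exists a b, v i0 j0 a b != 0.
  apply: contrapT => nv; move/eqP: w0; apply; rewrite -[w _ _]lact_eps -(toC0_eps piP).
  rewrite (dual_expansion _ chi2E (@lact_toC0_linear _) (wr i0 j0)) big1 // => a _.
  rewrite big1 // => b _; suff -> : lact (toC0 (chi2 a b)) (w i0 j0) = 0 by rewrite scaler0.
  by apply/eqP/negPn/negP => vij; apply: nv; exists a, b.
exists (fun i a => v i0 i a b0); last first.
  by move=> i j; apply: (proj2 (sN _ _ _)); apply: (proj1 (sN _ _ _)).
split=> [f i a|f i a|]; last by exists j0, a0.
  rewrite /v -lact_ract wE linear_sum; apply: eq_bigr => e _; exact: linearZ.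
exact: vE.
Qed.

Variable z : 'I_d1 -> 'I_d2 -> C.
Hypothesis zF : frame z.

(** Matrix units isolate the coefficient [M i j] and move it to position (a, b). With [N] = 0 this
    yields independence of the z, with general [N] simplicity of their span. *)
Lemma frame_unit (N : {vspace C}) M i j a b : subbicomodule pi N ->
  mxcomb z M \in N -> M i j *: z a b \in N.
Proof.
move=> /(subbicomoduleP piP) sN zN; have [zr zl _] := zF.
have [_ _ [chi1 chi1E]] := cc1; have [_ _ [chi2 chi2E]] := cc2.
suff -> : M i j *: z a b = lact (toC0 (chi2 b j)) (ract (toC0 (chi1 i a)) (mxcomb z M)).
  by apply: (proj2 (sN _ _ _)); apply: (proj1 (sN _ _ _)).
have zr' i' j' : ract (toC0 (chi1 i a)) (z i' j') = (i' == i)%:R *: z a j'.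
  rewrite zr (bigD1 a) //= chi1E eqxx andbT [i == i']eq_sym big1 ?addr0 // => e ea.
  by rewrite chi1E [a == e]eq_sym (negPf ea) andbF scale0r.
have zl' i' j' : lact (toC0 (chi2 b j)) (z i' j') = (j' == j)%:R *: z i' b.
  rewrite zl (bigD1 b) //= chi2E eqxx [j == j']eq_sym big1 ?addr0 // => e ea.
  by rewrite chi2E [b == e]eq_sym (negPf ea) scale0r.
have E i' j' : lact (toC0 (chi2 b j)) (M i' j' *: ract (toC0 (chi1 i a)) (z i' j')) =
    (j' == j)%:R *: ((i' == i)%:R *: (M i' j' *: z a b)).
  rewrite linearZ /= zr' linearZ /= zl' !scalerA; congr (_ *: _).
  by rewrite [RHS]mulrC mulrA mulrAC.
rewrite lfun_mxcomb linear_sum /=.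
under eq_bigr => i' _ do rewrite linear_sum /=.
under eq_bigr => i' _ do under eq_bigr => j' _ do rewrite E.
under eq_bigr => i' _ do rewrite sum_delta.
by rewrite sum_delta.
Qed.

Lemma frame_free M : mxcomb z M = 0 -> M = 0.
Proof.
move=> M0; apply/matrixP => i j; rewrite mxE; have [_ _ [a [b zab]]] := zF.
have s0 : subbicomodule pi 0%VS.
  by apply/(subbicomoduleP piP) => f x; rewrite memv0 => /eqP->; rewrite !linear0 mem0v.
have := @frame_unit 0%VS M i j a b s0; rewrite M0 mem0v memv0 => /(_ isT).
by rewrite scaler_eq0 (negPf zab) orbF => /eqP.
Qed.

Lemma frame_simple : simple_subbicomodule pi (mxspan z).
Proof.
have [zr zl [i0 [j0 z0]]] := zF; split.
- apply/(subbicomoduleP piP) => f _ /mxspanP[M ->]; rewrite !lfun_mxcomb.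
  split; apply: memv_suml => i _; apply: memv_suml => j _; apply: memvZ.
    by rewrite zr; apply: memv_suml => a _; apply/memvZ/mem_mxspan.
  by rewrite zl; apply: memv_suml => a _; apply/memvZ/mem_mxspan.
- by move=> E; have := mem_mxspan z i0 j0; rewrite E memv0 (negPf z0).
move=> N sN Nz; have [->|N0] := eqVneq N 0%VS; first by left.
right; apply/eqP; rewrite eqEsubv Nz /=.
have xN := memv_pick N; have x0 : vpick N != 0 by rewrite vpick0.
have /mxspanP[M ME] := subvP Nz _ xN.
have [i [j Mij]] : exists i j, M i j != 0.
  apply: contrapT => M0; move/eqP: x0; apply; rewrite ME /mxcomb big1 // => i _.
  rewrite big1 // => j _; have [->|Mij] := eqVneq (M i j) 0; first by rewrite scale0r.
  by case: M0; exists i, j.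
apply: mxspan_sub => a b.
rewrite -[z a b]scale1r -(mulVf Mij) -scalerA memvZ //.
by apply: frame_unit => //; rewrite -ME.
Qed.

Local Notation W := 'rV[k]_d1.
Local Notation V := 'rV[k]_d2.

Let zrow i (v : V) : C := \sum_j v 0 j *: z i j.
Let zcol (w : W) j : C := \sum_i w 0 i *: z i j.
Let zform (w : W) (v : V) : C := \sum_i w 0 i *: zrow i v.

Let zformE w v : zform w v = \sum_j v 0 j *: zcol w j.
Proof.
rewrite /zform; under eq_bigr => i _ do rewrite scaler_sumr.
rewrite exchange_big; apply: eq_bigr => j _; rewrite scaler_sumr.
by apply: eq_bigr => i _; rewrite !scalerA mulrC.
Qed.

Let zform_delta i v : zform (delta_mx 0 i) v = zrow i v.
Proof.
rewrite /zform; under eq_bigr => a _ do rewrite mxE eqxx.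
exact: sum_delta.
Qed.

Let zrow_delta i j : zrow i (delta_mx 0 j) = z i j.
Proof.
rewrite /zrow; under eq_bigr => a _ do rewrite mxE eqxx.
exact: sum_delta.
Qed.

Let zcol_delta w j : \sum_b (delta_mx 0 j : V) 0 b *: zcol w b = zcol w j.
Proof.
under eq_bigr => a _ do rewrite mxE eqxx.
exact: sum_delta.
Qed.

Lemma zform_bilinear : bilinear_fun zform.
Proof.
split=> [v|w] a x y; rewrite scaler_sumr -big_split; apply: eq_bigr => i _ /=.
  by rewrite !mxE scalerDl -scalerA.
rewrite scalerA mulrC -scalerA -scalerDr; congr (_ *: _).
rewrite scaler_sumr -big_split; apply: eq_bigr => j _ /=.
by rewrite !mxE scalerDl -scalerA.
Qed.

Let zmap : 'Hom(tens W V, C) := lfun_of (@tens_elim_linear k W V C zform).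

Lemma zmapE w v : zmap (w ⊗ v) = zform w v.
Proof. by rewrite lfun_ofE tens_elimE //; apply: zform_bilinear. Qed.

(** The isomorphism sends e_i ⊗ e_j to z i j. Compatibility with the coactions is tested on pairs of
    functionals, where [rhoL] and [rhoR] become the actions prescribed by the frame. *)
Lemma frame_iso : iso_simple_tensor pi (mxspan c1) (mxspan c2) (mxspan z).
Proof.
have [zr zl _] := zF.
exists W, V, (left_coaction c1), (right_coaction c2), zmap; split.
- by split; [apply: simple_left_coaction|apply: simple_right_coaction].
- have coefE t : zmap t = mxcomb z (rV_coef t).
    rewrite lfun_ofE tens_elim_delta; last exact: zform_bilinear.
    by apply: eq_bigr => i _; apply: eq_bigr => j _; rewrite zform_delta zrow_delta.
  have tE t : t = \sum_i \sum_j rV_coef t i j *: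
      ((delta_mx 0 i : W) ⊗ (delta_mx 0 j : V)).
    by rewrite -[LHS]tens_elim_id tens_elim_delta //; lin.
  split; apply/eqP.
    rewrite -subv0; apply/subvP => t; rewrite memv_ker coefE memv0 => /eqP/frame_free t0.
    rewrite [t]tE t0 big1 // => i _; rewrite big1 // => j _.
    by rewrite mxE scale0r.
  rewrite eqEsubv; apply/andP; split; apply/subvP => x.
    by case/memv_imgP => t _ ->; rewrite coefE; apply/mxspanP; exists (rV_coef t).
  case/mxspanP => M ->; apply: mxcomb_mem => i j; apply/memv_imgP.
  exists (delta_mx 0 i ⊗ delta_mx 0 j); rewrite ?memvf // zmapE.
  by rewrite zform_delta zrow_delta.
- move=> w v; apply: tens_separate => f g.
  rewrite -slicelE slicel_rhoL zmapE /zform.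
  rewrite (linear_left_coaction c1 (L := fun t => tens_elim _ (tens_elim _ t))); last by lin.
  rewrite !linear_sum; apply: eq_bigr => i _; rewrite !linearZ /= -scaler_sumr; congr (_ *: _).
  transitivity (g (\sum_a f (c1 i a) *: zrow a v)).
    congr (g _); rewrite linear_sum.
    under eq_bigr => j _ do rewrite linearZ /= zr scaler_sumr.
    rewrite exchange_big; apply: eq_bigr => a _; rewrite scaler_sumr.
    by apply: eq_bigr => j _; rewrite !scalerA mulrC.
  rewrite linear_sum; apply: eq_bigr => a _.
  rewrite tens_elimE; last by split; [move=> v' a' x y|]; lin.
  by rewrite tens_elimE; [rewrite zmapE zform_delta linearZ|lin].
- move=> w v; apply: tens_separate => f g.
  rewrite -slicerE slicer_rhoR zmapE zformE.
  rewrite (linear_right_coaction c2 (L := fun t => tens_elim _ (tens_elim _ t))); last by lin.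
  rewrite !linear_sum; apply: eq_bigr => j _; rewrite !linearZ /= -scaler_sumr; congr (_ *: _).
  transitivity (f (\sum_b g (c2 b j) *: zcol w b)).
    congr (f _); rewrite linear_sum.
    under eq_bigr => i _ do rewrite linearZ /= zl scaler_sumr.
    rewrite exchange_big; apply: eq_bigr => b _; rewrite scaler_sumr.
    by apply: eq_bigr => i _; rewrite !scalerA mulrC.
  rewrite linear_sum; apply: eq_bigr => b _.
  rewrite tens_elimE; last by lin.
  rewrite tens_elimE; last by lin.
  by rewrite zmapE zformE zcol_delta linearZ; apply: mulrC.
Qed.

End Frame.

Theorem block_neq0 (Q : nat -> {vspace C}) n x d1 d2
    (c1 : 'I_d1 -> 'I_d1 -> C) (c2 : 'I_d2 -> 'I_d2 -> C) :
  block_complements pi Q ->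
  (0 < d1)%N -> (0 < d2)%N -> comatrix c1 -> comatrix c2 ->
  x \in corad_filtration n.+1 -> x \notin (corad_filtration n : {vspace C}) ->
  (forall f, annihilates f (mxspan c1) -> ract f x \in corad_filtration n) ->
  (forall f, annihilates f (mxspan c2) -> lact f x \in corad_filtration n) ->
  block pi Q n.+1 d1 d2 <> 0%VS.
Proof.
move=> QP d10 d20 cc1 cc2 xn1 xn xl xr.
have [q [qQ q0 ql qr]] := Q_component piP QP d10 d20 cc1 cc2 xn1 xn xl xr.
have [sQ _ _] := QP n.
have [z zF zQ] := frame_of_component cc1 cc2 sQ qQ q0 ql qr.
have [_ zn0 _] := frame_simple cc1 cc2 zF.
apply: (@sumv_pred_neq0 _ _ _ (isotypic pi (Q n.+1) (mxspan c1) (mxspan c2))).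
  exists (mxspan c1), (mxspan c2); split=> //; split.
  - exact: comatrix_simple.
  - exact: comatrix_degree.
  - exact: comatrix_simple.
  - exact: comatrix_degree.
apply: (@sumv_pred_neq0 _ _ _ (mxspan z)) => //; split.
- exact: (frame_simple cc1 cc2 zF).
- exact: mxspan_sub.
exact: frame_iso.
Qed.

End BlockNonzeroTheorem.

(** * Sweedler calculus in a Hopf algebra *)

Notation "'\sw_' ( a , b <- x ) F" := (tens_elim (fun a b => F) (comul x))
  (at level 41, a name, b name, x at level 50, F at level 41,
   format "'\sw_' ( a ,  b  <-  x )  F") : ring_scope.

Section Sweedler.
Variables (k : fieldType) (H : hopfAlgType k).
Implicit Types x y z r : H.
Local Notation S := (@antipode k H).
Local Notation eps := (eps H).

Lemma lact_sw (f : dual H) x : lact f x = \sw_(a, b <- x) f b *: a.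
Proof. exact: lactE. Qed.

Lemma ract_sw (f : dual H) x : ract f x = \sw_(a, b <- x) f a *: b.
Proof. exact: ractE. Qed.

Lemma sw_exchange (W : vectType k) (F : H -> H -> H -> H -> W) x y :
  \sw_(a, b <- x) \sw_(c, d <- y) F a b c d = \sw_(c, d <- y) \sw_(a, b <- x) F a b c d.
Proof.
pose G i j m n := comul x i j *: (comul y m n *:
  F (vbasis {:H})`_i (vbasis {:H})`_j (vbasis {:H})`_m (vbasis {:H})`_n).
transitivity (\sum_i \sum_j \sum_m \sum_n G i j m n).
  apply: eq_bigr => i _; apply: eq_bigr => j _; rewrite scaler_sumr; apply: eq_bigr => m _.
  by rewrite scaler_sumr.
transitivity (\sum_i \sum_m \sum_j \sum_n G i j m n).
  by apply: eq_bigr => i _; apply: exchange_big.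
rewrite exchange_big; apply: eq_bigr => m _.
transitivity (\sum_i \sum_n \sum_j G i j m n).
  by apply: eq_bigr => i _; apply: exchange_big.
rewrite exchange_big; apply: eq_bigr => n _ /=.
rewrite /tens_elim scaler_sumr; apply: eq_bigr => i _.
rewrite scaler_sumr; apply: eq_bigr => j _.
by rewrite /G !scalerA mulrC.
Qed.

Lemma sw_epsl (W : vectType k) (F : H -> W) x : linear F ->
  \sw_(a, b <- x) eps a *: F b = F x.
Proof.
move=> lF; rewrite -[in RHS](ract_eps x) ract_sw tens_elim_lin //.
by apply: eq_tens_elim => a b; rewrite (linearZ_fun _ _ lF).
Qed.

Lemma sw_epsr (W : vectType k) (F : H -> W) x : linear F ->
  \sw_(a, b <- x) eps b *: F a = F x.
Proof.
move=> lF; rewrite -[in RHS](lact_eps x) lact_sw tens_elim_lin //.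
by apply: eq_tens_elim => a b; rewrite (linearZ_fun _ _ lF).
Qed.

Lemma sw_mul (W : vectType k) (F : H -> H -> W) x y : bilinear_fun F ->
  tens_elim F (comul (x * y)) = \sw_(a, b <- x) \sw_(c, d <- y) F (a * c) (b * d).
Proof.
move=> bF; have [F1 F2] := bF.
rewrite comulM /tens_mul tens_elim_lin; last exact: tens_elim_linear.
apply: eq_tens_elim => a b; rewrite tens_elim_lin; last exact: tens_elim_linear.
by apply: eq_tens_elim => c d; rewrite tens_elimE.
Qed.

Lemma sw_one (W : vectType k) (F : H -> H -> W) : bilinear_fun F ->
  tens_elim F (comul (1 : H)) = F 1 1.
Proof. by move=> bF; rewrite comul1 tens_elimE. Qed.

Lemma eps1 : eps 1 = 1 :> k. Proof. exact: counit1. Qed.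

Lemma epsM x y : eps (x * y) = eps x *: eps y. Proof. exact: (counitM x y). Qed.

Lemma sw_Sl x : \sw_(a, b <- x) S a * b = eps x *: 1.
Proof. exact: antipodel. Qed.

Lemma sw_Sr x : \sw_(a, b <- x) a * S b = eps x *: 1.
Proof. exact: antipoder. Qed.

Section Contraction.
Variables (W : vectType k) (L : H -> H -> W).
Hypothesis bL : bilinear_fun L.

Lemma sw_contract_l r :
  \sw_(a, s <- r) \sw_(b, c <- s) L (S a * b) c = L 1 r.
Proof.
have [L1 L2] := bL; rewrite (sw_assoc (F := fun a b c => L (S a * b) c)).
- rewrite -[RHS](sw_epsl _ (L2 1)); apply: eq_tens_elim => m c.
  rewrite -(linearZ_fun _ _ (L1 c)) -sw_Sl (tens_elim_lin (L := fun m => L m c)) //.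
- by move=> b c a x y; rewrite linearP mulrDl -scalerAl L1.
- by move=> a c b x y; rewrite mulrDr -scalerAr L1.
by [].
Qed.

Lemma sw_contract_r r :
  \sw_(a, s <- r) \sw_(b, c <- s) L (a * S b) c = L 1 r.
Proof.
have [L1 L2] := bL; rewrite (sw_assoc (F := fun a b c => L (a * S b) c)).
- rewrite -[RHS](sw_epsl _ (L2 1)); apply: eq_tens_elim => m c.
  rewrite -(linearZ_fun _ _ (L1 c)) -sw_Sr (tens_elim_lin (L := fun m => L m c)) //.
- by move=> b c a x y; rewrite mulrDl -scalerAl L1.
- by move=> a c b x y; rewrite linearP mulrDr -scalerAr L1.
by [].
Qed.

Lemma sw_contract_last_l r :
  \sw_(p, s <- r) \sw_(a, b <- s) L p (S a * b) = L r 1.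
Proof.
have [L1 L2] := bL; rewrite -[RHS](sw_epsr _ (L1 1)); apply: eq_tens_elim => p s.
by rewrite -(linearZ_fun _ _ (L2 p)) -sw_Sl (tens_elim_lin (L := L p)).
Qed.

Lemma sw_contract_last_r r :
  \sw_(p, s <- r) \sw_(a, b <- s) L p (a * S b) = L r 1.
Proof.
have [L1 L2] := bL; rewrite -[RHS](sw_epsr _ (L1 1)); apply: eq_tens_elim => p s.
by rewrite -(linearZ_fun _ _ (L2 p)) -sw_Sr (tens_elim_lin (L := L p)).
Qed.

End Contraction.

Lemma antipode1 : S 1 = 1.
Proof.
have := sw_Sl 1; rewrite sw_one ?mulr1 ?eps1 ?scale1r //.
by lin.
Qed.

(** Evaluate S(x_1 y_1) x_2 y_2 S(y_3) S(x_3) in two ways: cancelling y_2 S(y_3) and then x_2 S(x_3)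
    gives S(x y), cancelling S(x_1 y_1) x_2 y_2 gives S(y) S(x). *)
Lemma antipodeM x y : S (x * y) = S y * S x.
Proof.
pose E := \sw_(a, b <- x) \sw_(e, f <- b) \sw_(c, d <- y) \sw_(g, h <- d)
   S (a * c) * (e * (g * S h) * S f).
transitivity E.
  transitivity (\sw_(a, b <- x) \sw_(e, f <- b) S (a * y) * (e * S f)); last first.
    apply: eq_tens_elim => a b; apply: eq_tens_elim => e f.
    rewrite (sw_contract_last_r (L := fun c m => S (a * c) * (e * m * S f))) ?mulr1 //.
    by lin.
  by rewrite (sw_contract_last_r (L := fun a m => S (a * y) * m)) ?mulr1 //; lin.
transitivity (\sw_(m, f <- x) \sw_(n, h <- y)
  (\sw_(a, e <- m) \sw_(c, g <- n) S (a * c) * (e * g)) * (S h * S f)).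
  rewrite /E (sw_assoc (F := fun a e f => \sw_(c, d <- y) \sw_(g, h <- d)
   S (a * c) * (e * (g * S h) * S f))); try by lin.
  apply: eq_tens_elim => m f.
  transitivity (\sw_(a, e <- m) \sw_(n, h <- y) \sw_(c, g <- n)
     S (a * c) * (e * (g * S h) * S f)).
    apply: eq_tens_elim => a e.
    by rewrite (sw_assoc (F := fun c g h => S (a * c) * (e * (g * S h) * S f))); try by lin.
  rewrite sw_exchange; apply: eq_tens_elim => n h.
  rewrite (tens_elim_lin (L := fun z => z * (S h * S f))); last by lin.
  apply: eq_tens_elim => a e; rewrite (tens_elim_lin (L := fun z => z * (S h * S f))); last by lin.
  by apply: eq_tens_elim => c g; rewrite !mulrA.
transitivity (\sw_(m, f <- x) \sw_(n, h <- y) eps m *: (eps n *: (S h * S f))).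
  apply: eq_tens_elim => m f; apply: eq_tens_elim => n h.
  rewrite -(sw_mul (F := fun a b => S a * b)); last by lin.
  by rewrite sw_Sl epsM -scalerAl mul1r -scalerA.
transitivity (\sw_(m, f <- x) eps m *: (S y * S f)).
  apply: eq_tens_elim => m f; rewrite -tens_elim_lin; last by lin.
  by rewrite (sw_epsl (F := fun h => S h * S f)) //; lin.
by rewrite (sw_epsl (F := fun f => S y * S f)) //; lin.
Qed.

(** As for products, Delta(S x_1) Delta(x_2) (S x_4 ⊗ S x_3) is evaluated in two ways: either the
    first two factors cancel or the last two do. *)
Lemma sw_antipode (W : vectType k) (F : H -> H -> W) x : bilinear_fun F ->
  tens_elim F (comul (S x)) = \sw_(a, b <- x) F (S b) (S a).
Proof.
move=> bF; have [F1 F2] := bF.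
have lF1 (X : vectType k) (u : X -> H) v : linear u -> linear (fun t => F (u t) v).
  by move=> lu a s t; rewrite lu F1.
have lF2 (X : vectType k) (u : X -> H) v : linear u -> linear (fun t => F v (u t)).
  by move=> lu a s t; rewrite lu F2.
pose E := \sw_(a, b <- x) \sw_(e, f <- b) \sw_(g, h <- f)
   \sw_(p, q <- S a) \sw_(u, v <- e) F (p * u * S h) (q * v * S g).
transitivity E; last first.
  pose L m f := \sw_(g, h <- f) \sw_(p, q <- m) F (p * S h) (q * S g).
  have bL : bilinear_fun L by rewrite /L; lin.
  transitivity (\sw_(a, b <- x) \sw_(e, f <- b) L (S a * e) f).
    apply: eq_tens_elim => a b; apply: eq_tens_elim => e f; apply: eq_tens_elim => g h.
    rewrite (sw_mul (F := fun p q => F (p * S h) (q * S g))) //.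
    by split=> [v|u]; [apply: lF1|apply: lF2]; lin.
  rewrite (sw_contract_l bL) /L; apply: eq_tens_elim => g h.
  rewrite (sw_one (F := fun p q => F (p * S h) (q * S g))) ?mul1r //.
  by split=> [v|u]; [apply: lF1|apply: lF2]; lin.
have lsw (X : vectType k) (G : H -> H -> X) (u : H -> H) :
    linear u -> linear (fun t => tens_elim G (comul (u t))).
  by move=> lu a s t; rewrite lu linearP tens_elim_linear.
transitivity (\sw_(a, b <- x) eps b *: (\sw_(p, q <- S a) F p q)).
  rewrite (sw_epsr (F := fun a => \sw_(p, q <- S a) F p q)) //.
  by apply: lsw; lin.
apply: eq_tens_elim => a b.
transitivity (\sw_(p, q <- S a) \sw_(u, r <- b) F (p * (u * S r)) q).
  rewrite tens_elim_lin; last by lin.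
  apply: eq_tens_elim => p q.
  rewrite -(tens_elim_lin (L := fun z => F (p * z) q)); last by apply: lF1; lin.
  by rewrite sw_Sr -scalerAr mulr1 (linearZ_fun _ _ (F1 q)).
transitivity (\sw_(p, q <- S a) \sw_(e, f <- b) \sw_(u, v <- e) \sw_(g, h <- f)
     F (p * u * S h) (q * v * S g)); last first.
  rewrite sw_exchange; apply: eq_tens_elim => e f.
  transitivity (\sw_(p, q <- S a) \sw_(g, h <- f) \sw_(u, v <- e)
     F (p * u * S h) (q * v * S g)); last by rewrite sw_exchange.
  by apply: eq_tens_elim => p q; rewrite sw_exchange.
apply: eq_tens_elim => p q.
rewrite -(sw_assoc (F := fun u v f => \sw_(g, h <- f) F (p * u * S h) (q * v * S g))).
- apply: eq_tens_elim => u r.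
  transitivity (\sw_(v, f <- r) \sw_(g, h <- f) F (p * u * S h) (q * (v * S g))); last first.
    by apply: eq_tens_elim => v f; apply: eq_tens_elim => g h; rewrite mulrA.
  rewrite (sw_contract_r (L := fun m h => F (p * u * S h) (q * m))) ?mulr1 ?mulrA //.
  by split=> [v|m]; [apply: lF2|apply: lF1]; lin.
- by move=> v f; apply: is_linear_tens_elim_fun => g h; apply: lF1; lin.
- by move=> v f; apply: is_linear_tens_elim_fun => g h; apply: lF2; lin.
by move=> u v; apply: lsw; lin.
Qed.

Lemma eps_antipode x : eps (S x) = eps x.
Proof.
have lS : linear (fun a => eps (S a)) by lin.
rewrite -(sw_epsr x lS); transitivity (eps (\sw_(a, b <- x) S a * b)).
  rewrite (tens_elim_lin (L := eps)); last by lin.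
  by apply: eq_tens_elim => a b; rewrite epsM; apply: mulrC.
by rewrite sw_Sl linearZ /= eps1; apply: mulr1.
Qed.

End Sweedler.

(** * Integrals and the Frobenius property *)

Section Integrals.
Variables (k : fieldType) (H : hopfAlgType k).
Implicit Types (phi psi : dual H) (x y z r : H).
Local Notation S := (@antipode k H).
Local Notation eps := (eps H).
Local Notation h_ i := ((vbasis {:H})`_i).

Definition left_integral phi := forall x, lact phi x = (phi x : k) *: (1 : H).
Definition right_integral phi := forall x, ract phi x = (phi x : k) *: (1 : H).

Lemma sw_lact (W : vectType k) (G : H -> H -> W) phi z : bilinear_fun G ->
  \sw_(p, q <- lact phi z) G p q = \sw_(p, r <- z) G p (lact phi r).
Proof.
move=> bG; have [G1 G2] := bG.
transitivity (\sw_(m, s <- z) \sw_(p, q <- m) phi s *: G p q).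
  rewrite lact_sw (tens_elim_lin (L := fun t => tens_elim G (comul t))); last by lin.
  apply: eq_tens_elim => m s; rewrite linearZ (linearZ_fun _ _ (@tens_elim_linear _ _ _ _ G)).
  by rewrite tens_elim_lin //; lin.
rewrite -(sw_assoc (F := fun p q s => phi s *: G p q)); try by lin.
apply: eq_tens_elim => p r; rewrite lact_sw (tens_elim_lin (L := G p)) //.
by apply: eq_tens_elim => q s; rewrite (linearZ_fun _ _ (G2 p)).
Qed.

Lemma sum_dbasis (W : vectType k) (F : H -> W) x : linear F ->
  \sum_(i < \dim {:H}) dbasis i x *: F (h_ i) = F x.
Proof.
move=> lF; rewrite [in RHS](dbasis_sum x) (linear_sum_fun _ _ _ lF).
by apply: eq_bigr => i _; rewrite (linearZ_fun _ _ lF).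
Qed.

(* The projection [phi |-> \sum_i (h^i * phi) . S h_i] of the right Hopf module dual H onto its
   coinvariants, written as the trace of [y |-> lact phi (x * S (S y))]. *)
Definition integral_fun phi x : k^o :=
  \sum_(i < \dim {:H}) dbasis i (lact phi (x * S (S (h_ i)))).

Lemma integral_fun_linear phi : linear (integral_fun phi).
Proof. by rewrite /integral_fun; lin. Qed.

Definition integral_of phi : dual H := lfun_of (integral_fun_linear phi).

Lemma integral_ofE phi x :
  integral_of phi x = \sum_(i < \dim {:H}) dbasis i (lact phi (x * S (S (h_ i)))).
Proof. exact: lfun_ofE. Qed.

Lemma sw_antipode2 (W : vectType k) (F : H -> H -> W) x : bilinear_fun F ->
  tens_elim F (comul (S (S x))) = \sw_(a, b <- x) F (S (S a)) (S (S b)).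
Proof.
move=> bF; have [F1 F2] := bF; rewrite !sw_antipode //.
by split=> [v|u] a y z; rewrite linearP ?F1 ?F2.
Qed.

(** On the right-hand side the argument of psi is x_1 S(S(y_2)) S(y_1) = x_1 S(y_1 S(y_2)), which
    collapses to x_1. *)
Lemma sw_lact_twist phi psi x y :
  \sw_(a, b <- x) psi a *: lact phi (b * S (S y)) =
  \sw_(c, d <- y) \sw_(p, q <- lact phi (x * S (S d))) psi (p * S c) *: q.
Proof.
symmetry.
pose L m v := \sw_(a, b <- x) psi (a * S m) *: lact phi (b * S (S v)).
transitivity (\sw_(c, d <- y) \sw_(u, v <- d) L (c * S u) v).
  apply: eq_tens_elim => c d; rewrite sw_lact; last by lin.
  rewrite (sw_mul (F := fun p r => psi (p * S c) *: lact phi r)); last by lin.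
  rewrite /L [RHS]sw_exchange; apply: eq_tens_elim => a b.
  rewrite sw_antipode2; last by lin.
  by apply: eq_tens_elim => u v; rewrite antipodeM mulrA.
rewrite sw_contract_r; last by rewrite /L; lin.
by rewrite /L antipode1; apply: eq_tens_elim => a b; rewrite mulr1.
Qed.

Lemma mulr3C (a b c : k) : a * (b * c) = c * (b * a).
Proof. by rewrite [RHS]mulrC [b * a]mulrC mulrA. Qed.

(** By [sw_lact_twist], convolving with psi gives the trace of a composite of two maps. Exchanging
    the sums over i and j is cyclicity of the trace; afterwards a leg meets the antipode of the next
    one, and the contraction leaves psi(1). *)
Lemma integral_of_left phi : left_integral (integral_of phi).
Proof.
move=> x; apply: functional_separate => psi.
rewrite -conv_lact convE linearZ /=.
pose t d := lact phi (x * S (S d)).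
have lt : linear t by rewrite /t; lin.
transitivity (\sum_(i < \dim {:H}) \sum_(j < \dim {:H}) \sw_(c, d <- h_ i)
    dbasis j (t d) *: (\sw_(p, q <- h_ j) psi (p * S c) *: dbasis i q)).
  under eq_tens_elim => a b do rewrite integral_ofE scaler_sumr.
  rewrite tens_elim_sum; apply: eq_bigr => i _.
  transitivity (dbasis i (\sw_(a, b <- x) psi a *: lact phi (b * S (S (h_ i))))).
    rewrite (tens_elim_lin (L := dbasis i)); last by lin.
    by apply: eq_tens_elim => a b; rewrite linearZ.
  rewrite sw_lact_twist (tens_elim_lin (L := dbasis i)); last by lin.
  rewrite -tens_elim_sum; apply: eq_tens_elim => c d.
  rewrite (sum_dbasis (F := fun y => \sw_(p, q <- y) psi (p * S c) *: dbasis i q)); last by lin.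
  rewrite (tens_elim_lin (L := dbasis i)); last by lin.
  by apply: eq_tens_elim => p q; rewrite linearZ.
rewrite exchange_big integral_ofE scaler_suml; apply: eq_bigr => j _ /=.
transitivity (\sw_(p, q <- h_ j) \sw_(c, d <- q) psi (p * S c) *: dbasis j (t d)); last first.
  rewrite (sw_contract_r (L := fun m d => psi m *: dbasis j (t d))); last by lin.
  exact: mulrC.
transitivity (\sw_(p, q <- h_ j) \sum_(i < \dim {:H})
    dbasis i q *: \sw_(c, d <- h_ i) psi (p * S c) *: dbasis j (t d)); last first.
  apply: eq_tens_elim => p q.
  by rewrite (sum_dbasis (F := fun y => \sw_(c, d <- y) psi (p * S c) *: dbasis j (t d))) //; lin.
rewrite tens_elim_sum; apply: eq_bigr => i _.
transitivity (\sw_(c, d <- h_ i) \sw_(p, q <- h_ j)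
    dbasis j (t d) *: (psi (p * S c) *: dbasis i q)).
  by apply: eq_tens_elim => c d; rewrite tens_elim_lin //; lin.
rewrite sw_exchange; apply: eq_tens_elim => p q.
rewrite tens_elim_lin; last by lin.
by apply: eq_tens_elim => c d; apply: mulr3C.
Qed.

(** The integrals obtained from the dual basis, evaluated at the corresponding S h_i, add up to
    eps(1) = 1 by the antipode axiom, so one of them is nonzero. *)
Lemma left_integral_exists : exists2 phi, left_integral phi & phi != 0.
Proof.
have sum1 : \sum_(i < \dim {:H}) integral_of (dbasis i) (S (h_ i)) = 1 :> k^o.
  transitivity (\sum_(l < \dim {:H}) \sw_(a, b <- h_ l) dbasis l (S (S a * b))).
    transitivity (\sum_(l < \dim {:H}) \sum_(i < \dim {:H}) \sum_(j < \dim {:H})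
        \sw_(a, b <- h_ l) dbasis i b *: (dbasis j a *: dbasis l (S (S (h_ j) * h_ i)))).
      rewrite exchange_big; apply: eq_bigr => i _ /=.
      rewrite exchange_big integral_ofE; apply: eq_bigr => j _ /=.
      rewrite -antipodeM -conv_lact -(sum_dbasis (F := conv (dbasis j) (dbasis i))); last by lin.
      apply: eq_bigr => l _; rewrite convE tens_elim_lin; last by lin.
      by apply: eq_tens_elim => a b; apply: mulr3C.
    apply: eq_bigr => l _.
    transitivity (\sw_(a, b <- h_ l) \sum_(i < \dim {:H}) \sum_(j < \dim {:H})
       dbasis i b *: (dbasis j a *: dbasis l (S (S (h_ j) * h_ i)))).
      by rewrite tens_elim_sum; apply: eq_bigr => i _; rewrite tens_elim_sum.
    apply: eq_tens_elim => a b.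
    rewrite -(sum_dbasis (F := fun b => dbasis l (S (S a * b)))); last by lin.
    apply: eq_bigr => i _; rewrite -scaler_sumr; congr (_ *: _).
    by rewrite (sum_dbasis (F := fun a => dbasis l (S (S a * h_ i)))) //; lin.
  transitivity (\sum_(l < \dim {:H}) dbasis l (1 : H) *: eps (h_ l)).
    apply: eq_bigr => l _; rewrite -(tens_elim_lin (L := fun z => dbasis l (S z))); last by lin.
    by rewrite sw_Sl !linearZ /= antipode1; apply: mulrC.
  by rewrite (sum_dbasis (F := eps)) ?eps1 //; lin.
apply: contrapT => no; have /eqP := sum1; rewrite big1 ?(eq_sym 0) ?oner_eq0 // => i _.
have -> : integral_of (dbasis i) = 0; last by rewrite zero_lfunE.
apply/eqP/negPn/negP => nz; apply: no; exists (integral_of (dbasis i)) => //.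
exact: integral_of_left.
Qed.

Section Nondegenerate.
Variable lam : dual H.
Hypotheses (lamI : left_integral lam) (lam0 : lam != 0).

(** Use the integral property at x S(r_1), whose comultiplication is x_1 S(r_2) ⊗ x_2 S(r_1) after
    renumbering; then S(r_2) r_3 cancels. *)
Lemma integral_twist x r :
  \sw_(a, b <- r) lam (x * S a) *: b = \sw_(c, d <- x) lam (d * S r) *: c.
Proof.
pose L u m := \sw_(c, d <- x) lam (d * S u) *: (c * m).
transitivity (L r 1); last by apply: eq_tens_elim => c d; rewrite mulr1.
rewrite -(sw_contract_last_l (L := L)); last by rewrite /L; lin.
rewrite (sw_assoc (F := fun u v b => L u (S v * b))); try by rewrite /L; lin.
apply: eq_tens_elim => a b.
transitivity (((lam (x * S a) : k) *: (1 : H)) * b); first by rewrite -scalerAl mul1r.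
rewrite -lamI lact_sw (tens_elim_lin (L := fun z => z * b)); last by lin.
rewrite (sw_mul (F := fun c d => ((lam d : k) *: c) * b)); last by lin.
rewrite /L.
transitivity (\sw_(c, d <- x) \sw_(u, v <- a) lam (d * S u) *: (c * (S v * b))).
  apply: eq_tens_elim => c d.
  rewrite (sw_antipode (F := fun p q => ((lam (d * q) : k) *: (c * p)) * b)); last by lin.
  by apply: eq_tens_elim => u v; rewrite -scalerAl mulrA.
by rewrite sw_exchange.
Qed.

(* The r with lam (x * S r) = 0 for all x form a right coideal by [integral_twist]; contracting with
   a_1 S(a_2) = eps(a) shows that lam would vanish unless this coideal is zero. *)
Lemma integral_antipode_inj r : (forall x, lam (x * S r) = 0) -> r = 0.
Proof.
move=> r0; have twist0 x : \sw_(a, b <- r) lam (x * S a) *: b = 0.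
  rewrite integral_twist /tens_elim big1 // => i _; rewrite big1 // => j _.
  by rewrite r0 scale0r scaler0.
have [x lamx] : exists x, lam x != 0.
  apply: contrapT => no; move/eqP: lam0; apply; apply/lfunP => x; rewrite zero_lfunE.
  by apply/eqP/negPn/negP => nz; apply: no; exists x.
apply: functional_separate => psi; rewrite linear0; apply/eqP.
suff /eqP : lam x *: psi r = 0 by rewrite scaler_eq0 (negPf lamx).
pose L a1 m := \sw_(a2, b <- m) psi b *: lam (x * S (S a2) * S a1).
transitivity (\sw_(a, m <- r) L a m).
  rewrite (sw_assoc (F := fun a1 a2 b => psi b *: lam (x * S (S a2) * S a1))); try by lin.
  transitivity (\sw_(a, b <- r) eps a *: (psi b *: lam x)).
    rewrite (sw_epsl (F := fun b => psi b *: lam x)); last by lin.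
    exact: mulrC.
  apply: eq_tens_elim => a b.
  transitivity (psi b *: lam (x * S (\sw_(a1, a2 <- a) a1 * S a2))).
    have Seps : S ((eps a : k) *: (1 : H)) = (eps a : k) *: (1 : H) by rewrite linearZ /= antipode1.
    rewrite sw_Sr Seps -scalerAr mulr1 (linearZ_fun _ _ (is_linear_lfun lam (@is_linear_id _ _))).
    exact: mulrCA.
  rewrite (tens_elim_lin (L := fun z => psi b *: lam (x * S z))); last by lin.
  by apply: eq_tens_elim => a1 a2; rewrite antipodeM mulrA.
transitivity (\sum_(j < \dim {:H}) \sw_(a, m <- r) dbasis j m *: L a (h_ j)).
  rewrite -tens_elim_sum; apply: eq_tens_elim => a m.
  by rewrite (sum_dbasis (F := L a)) // /L; lin.
rewrite big1 // => j _.
transitivity (\sw_(a2, b <- h_ j) psi b *: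
    dbasis j (\sw_(a, m <- r) lam (x * S (S a2) * S a) *: m)).
  transitivity (\sw_(a, m <- r) \sw_(a2, b <- h_ j)
      dbasis j m *: (psi b *: lam (x * S (S a2) * S a))).
    by apply: eq_tens_elim => a m; rewrite /L tens_elim_lin //; lin.
  rewrite sw_exchange; apply: eq_tens_elim => a2 b.
  rewrite (tens_elim_lin (L := fun z => psi b *: dbasis j z)); last by lin.
  apply: eq_tens_elim => a m.
  rewrite (linearZ_fun _ _ (is_linear_lfun (dbasis j) (@is_linear_id _ _))).
  exact: (etrans (mulrCA _ _ _) (congr1 _ (mulrC _ _))).
have zero a2 : \sw_(a, m <- r) lam (x * S (S a2) * S a) *: m = 0 by apply: twist0.
rewrite /tens_elim big1 // => i _; rewrite big1 // => l _.
by have := zero (vbasis {:H})`_i; rewrite /tens_elim => ->; rewrite linear0 !scaler0.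
Qed.

Lemma antipode_ker0 : lker S == 0%VS.
Proof.
rewrite -subv0; apply/subvP => x; rewrite memv_ker memv0 => /eqP Sx0; apply/eqP.
by apply: integral_antipode_inj => y; rewrite Sx0 mulr0 linear0.
Qed.

(** By [integral_antipode_inj] the map sending r to the functional lam(- S r) is injective, hence
    onto the dual by dimension, and so takes the value eps. The dual is identified with H through
    the chosen basis. *)
Lemma dual_integral_exists : exists L, forall x, lam (x * L) = eps x.
Proof.
have lT : linear (fun r => \sum_(i < \dim {:H}) lam (h_ i * S r) *: h_ i : H) by lin.
have kerT : lker (lfun_of lT) == 0%VS.
  rewrite -subv0; apply/subvP => r; rewrite memv_ker memv0 lfun_ofE => /eqP Tr.
  have lamr (j : 'I_(\dim {:H})) : lam (h_ j * S r) = 0.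
    by have := congr1 (dbasis j) Tr; rewrite linear0 dbasis_comb.
  apply/eqP/integral_antipode_inj => x.
  rewrite -(sum_dbasis (F := fun x => lam (x * S r))); last by lin.
  by rewrite big1 // => j _; rewrite lamr scaler0.
pose y : H := \sum_(i < \dim {:H}) eps (h_ i) *: h_ i.
have : y \in limg (lfun_of lT) by rewrite lker0_limgf ?memvf.
case/memv_imgP => r _ yE; exists (S r) => x.
have lamr (j : 'I_(\dim {:H})) : lam (h_ j * S r) = eps (h_ j).
  by have := congr1 (dbasis j) yE; rewrite lfun_ofE !dbasis_comb.
rewrite -(sum_dbasis (F := fun x => lam (x * S r))); last by lin.
rewrite -(sum_dbasis (F := eps)); last by lin.
by apply: eq_bigr => j _; rewrite lamr.
Qed.

(** Take phi = lam(x -). Then L_1 lam(x L_2) = S(x_1) x_2 L_1 lam(x_3 L_2) = S(x_1) lam(x_2 L) =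
    S(x), the middle equality being the integral property at x_2 L. *)
Lemma lact_dual_integral L x : (forall x, lam (x * L) = eps x) ->
  exists phi, lact phi L = S x.
Proof.
move=> LE; have lphi : linear (fun y => lam (x * y)) by lin.
exists (lfun_of lphi); rewrite lact_sw.
pose E := \sw_(p, r <- x) \sw_(q, s <- r) \sw_(a, b <- L) (lam (s * b) : k) *: (S p * q * a).
transitivity E.
  rewrite /E (sw_contract_l (L := fun m s => \sw_(a, b <- L) (lam (s * b) : k) *: (m * a))); last by lin.
  by apply: eq_tens_elim => a b; rewrite lfun_ofE mul1r.
rewrite -[RHS](sw_epsr (F := S)); last by lin.
apply: eq_tens_elim => p r.
transitivity (S p * lact lam (r * L)).
  rewrite lact_sw (sw_mul (F := fun a b => (lam b : k) *: a)); last by lin.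
  rewrite (tens_elim_lin (L := fun z => S p * z)); last by lin.
  apply: eq_tens_elim => q s; rewrite (tens_elim_lin (L := fun z => S p * z)); last by lin.
  by apply: eq_tens_elim => a b; rewrite -scalerAr mulrA.
by rewrite lamI LE -scalerAr mulr1.
Qed.

End Nondegenerate.

Lemma antipode_bij : lker S == 0%VS.
Proof. by have [lam lamI lam0] := left_integral_exists; apply: antipode_ker0 lamI lam0. Qed.

(** The integral and the bijectivity of the antipode give surjectivity for [lact]. Pairing through
    the convolution of two functionals at L turns this into injectivity for [ract], dimension makes
    [ract] surjective, and the pairing carries this back to injectivity for [lact]. *)
Theorem frobenius_element : exists L : H,
  [/\ forall x, exists phi, lact phi L = x, forall x, exists phi, ract phi L = x,
      forall phi, lact phi L = 0 -> phi = 0 & forall phi, ract phi L = 0 -> phi = 0].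
Proof.
have [lam lamI lam0] := left_integral_exists.
have [L LE] := dual_integral_exists lamI lam0.
have Ls x : exists phi, lact phi L = x.
  have : x \in limg S by rewrite lker0_limgf ?memvf // antipode_bij.
  by case/memv_imgP => y _ ->; apply: (lact_dual_integral lamI _ LE).
have Ri phi : ract phi L = 0 -> phi = 0.
  move=> R0; apply/lfunP => x; have [psi <-] := Ls x.
  by rewrite -conv_lact conv_ract R0 linear0 zero_lfunE.
have Rs x : exists phi, ract phi L = x.
  pose T := lfun_of (ract_fun_linear L).
  have kT : (fullv :&: lker T)%VS = 0%VS.
    apply/eqP; rewrite -subv0 capfv; apply/subvP => phi.
    by rewrite memv_ker lfun_ofE memv0 => /eqP/Ri->.
  have limT : limg T = fullv.
    apply/eqP; rewrite eqEdim subvf (limg_dim_eq kT) !dimvf /dim /= muln1 leqnn.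
    by [].
  have : x \in limg T by rewrite limT memvf.
  by case/memv_imgP => phi _ ->; exists phi; rewrite (lfun_ofE (ract_fun_linear L)).
exists L; split=> // phi L0; apply/lfunP => x; have [psi <-] := Rs x.
by rewrite -conv_ract conv_lact L0 linear0 zero_lfunE.
Qed.

End Integrals.

(** * Maschke's theorem and bijective coalgebra maps *)

Section Maschke.
Variables (k : closedFieldType) (H : hopfAlgType k).
Implicit Types (x y z : H).
Local Notation S := (@antipode k H).
Local Notation eps := (eps H).
Local Notation C0 := (@coradical k H).

Variable e : dual H.
Hypotheses (eI : right_integral e) (e1 : e 1 = 1).

(** Use the integral property at S(x_2) y, whose comultiplication is S(x_3) y_1 ⊗ S(x_2) y_2 after
    renumbering, and cancel x_1 S(x_2). *)
Lemma right_integral_twist x y :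
  \sw_(a, c <- x) e (S c * y) *: a = \sw_(u, v <- y) e (S x * u) *: v.
Proof.
pose L m c := \sw_(u, v <- y) (e (S c * u) : k) *: (m * v).
transitivity (L 1 x); last by apply: eq_tens_elim => u v; rewrite mul1r.
rewrite -(sw_contract_r (L := L)); last by rewrite /L; lin.
apply: eq_tens_elim => a c.
transitivity (a * ract e (S c * y)); first by rewrite eI -scalerAr mulr1.
rewrite ract_sw (tens_elim_lin (L := fun z => a * z)); last by lin.
rewrite (sw_mul (F := fun p q => a * ((e p : k) *: q))); last by lin.
rewrite (sw_antipode (F := fun p q => \sw_(u, v <- y) a * ((e (p * u) : k) *: (q * v)))); last by lin.
apply: eq_tens_elim => c1 c2; apply: eq_tens_elim => u v.
by rewrite -scalerAr mulrA.
Qed.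

(* Averaging a linear projection onto C0 with the integral makes it a comodule projection
   [lact beta]; its kernel would meet C0 if it were nonzero. *)
Lemma cosemisimple_of_integral : C0 = {:H}%VS.
Proof.
pose p := projv C0.
have lb : linear (fun b => \sw_(c, d <- b) e (S c * p d)) by lin.
pose beta : dual H := lfun_of lb.
have betaE b : beta b = \sw_(c, d <- b) e (S c * p d) by apply: lfun_ofE.
have PC0 x : lact beta x \in C0.
  have -> : lact beta x = \sw_(m, d <- x) ract (lfun_of
      (is_linear_lfun e (is_linear_mull (S m) (@is_linear_id _ H)))) (p d).
    transitivity (\sw_(a, b <- x) \sw_(c, d <- b) e (S c * p d) *: a).
      rewrite lact_sw; apply: eq_tens_elim => a b; rewrite betaE.
      by rewrite (tens_elim_lin (L := fun t : k^o => t *: a)) //; lin.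
    rewrite (sw_assoc (F := fun a c d => e (S c * p d) *: a)); try by lin.
    apply: eq_tens_elim => m d; rewrite right_integral_twist ract_sw.
    by apply: eq_tens_elim => u v; rewrite lfun_ofE.
  apply: memv_suml => i _; apply: memv_suml => j _; apply: memvZ.
  have /subcoalgebraP sC0 := coradical_subcoalgebra (C := H).
  by have [_] := sC0 _ (memv_proj C0 (vbasis {:H})`_j) (lfun_of
      (is_linear_lfun e (is_linear_mull (S (vbasis {:H})`_i) (@is_linear_id _ H)))).
have beta_eps : annihilates (beta - eps) C0.
  move=> b bC0; rewrite add_lfunE opp_lfunE betaE.
  suff -> : \sw_(c, d <- b) e (S c * p d) = eps b by rewrite subrr.
  transitivity (e (\sw_(c, d <- b) S c * d)).
    rewrite (tens_elim_lin (L := e)); last by lin.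
    have lD : linear (fun t : tens H H => tens_elim (fun c d => e (S c * p d)) t -
       tens_elim (fun c d => e (S c * d)) t).
      by move=> a s t; rewrite !tens_elim_linear scalerBr opprD addrACA.
    apply/eqP; rewrite -subr_eq0 -memv0.
    apply: (tensv_ind lD) (coradical_subcoalgebra bC0) => u v _ vC0.
    by rewrite !tens_elimE; try lin; rewrite /p projv_id // subrr mem0v.
  by rewrite sw_Sl linearZ /= e1 [_ *: _]mulr1.
have Pid x : x \in C0 -> lact beta x = x.
  move=> xC0; apply/eqP; rewrite -subr_eq0 -[in X in _ - X](lact_eps x) -lactB.
  by rewrite (lact_annihilates (@coradical_subcoalgebra _ H) beta_eps).
have P0 n x : x \in corad_filtration n -> lact beta x = 0 -> x = 0.
  elim: n x => [|n IH] x xn Px; first by rewrite -(Pid x).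
  have xC0 : x \in C0.
    apply: ract_rad_eq0 => f fJ; apply: IH; first by have /corad_ractP/(_ f fJ) := xn.
    by rewrite lact_ract Px linear0.
  by rewrite -(Pid x).
have [n nfull] := corad_exhaustive H.
have ker0 : lker (lact beta) == 0%VS.
  rewrite -subv0; apply/subvP => x; rewrite memv_ker memv0 => /eqP Px; apply/eqP.
  by apply: (P0 n) => //; rewrite nfull memvf.
apply/eqP; rewrite eqEsubv subvf -(lker0_limgf ker0).
by apply/subvP => _ /memv_imgP[x _ ->].
Qed.

End Maschke.

Section Bijections.
Variables (k : closedFieldType) (C : coalgType k).
Implicit Types (f g : dual C) (x y : C) (D : {vspace C}) (T : 'End(C)).
Local Notation C0 := (@coradical k C).

(** Stated on the transpose, as a homomorphism of the dual algebra, so that actions move across T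
    without tensors. *)
Definition coalgebra_map T :=
  (forall f g, (conv f g \o T = conv (f \o T) (g \o T))%VF) /\ (eps C \o T)%VF = eps C.

Definition coalgebra_antimap T :=
  (forall f g, (conv f g \o T = conv (g \o T) (f \o T))%VF) /\ (eps C \o T)%VF = eps C.

Lemma coalgebra_map_lact T f x : coalgebra_map T -> lact f (T x) = T (lact (f \o T)%VF x).
Proof.
move=> [TM _]; apply: functional_separate => g.
by rewrite -conv_lact -comp_lfunE TM conv_lact comp_lfunE.
Qed.

Lemma coalgebra_map_ract T f x : coalgebra_map T -> ract f (T x) = T (ract (f \o T)%VF x).
Proof.
move=> [TM _]; apply: functional_separate => g.
by rewrite -conv_ract -comp_lfunE TM conv_ract comp_lfunE.
Qed.

Lemma coalgebra_antimap_lact T f x : coalgebra_antimap T ->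
  lact f (T x) = T (ract (f \o T)%VF x).
Proof.
move=> [TM _]; apply: functional_separate => g.
by rewrite -conv_lact -comp_lfunE TM conv_ract comp_lfunE.
Qed.

Lemma coalgebra_antimap_ract T f x : coalgebra_antimap T ->
  ract f (T x) = T (lact (f \o T)%VF x).
Proof.
move=> [TM _]; apply: functional_separate => g.
by rewrite -conv_ract -comp_lfunE TM conv_lact comp_lfunE.
Qed.

Lemma comp_inv T f : lker T == 0%VS -> ((f \o T^-1) \o T)%VF = f.
Proof. by move=> T0; rewrite -comp_lfunA lker0_compVf // comp_lfun1r. Qed.

Section Image.
Variable T : 'End(C).
Hypotheses (T0 : lker T == 0%VS) (TM : coalgebra_map T \/ coalgebra_antimap T).

Lemma image_subcoalgebra D : subcoalgebra D -> subcoalgebra (T @: D)%VS.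
Proof.
move=> /subcoalgebraP sD; apply/subcoalgebraP => _ /memv_imgP[x xD ->] f.
have [xl xr] := sD x xD (f \o T)%VF.
case: TM => TM'.
  by rewrite coalgebra_map_lact // coalgebra_map_ract // !memv_img.
by rewrite coalgebra_antimap_lact // coalgebra_antimap_ract // !memv_img.
Qed.

Lemma preimage_subcoalgebra D : subcoalgebra D -> subcoalgebra (T @^-1: D)%VS.
Proof.
move=> /subcoalgebraP sD; apply/subcoalgebraP => x; rewrite -memv_preim => xD f.
rewrite -!memv_preim -[in lact f](comp_inv f T0) -[in ract f](comp_inv f T0).
have [xl xr] := sD _ xD (f \o T^-1)%VF.
case: TM => TM'.
  by rewrite -coalgebra_map_lact // -coalgebra_map_ract.
by rewrite -coalgebra_antimap_lact // -coalgebra_antimap_ract.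
Qed.

Lemma coalgebra_image_coradical : (T @: C0)%VS = C0.
Proof.
apply: coradical_image; first exact/eqP.
  exact: image_subcoalgebra.
exact: preimage_subcoalgebra.
Qed.

Lemma coalgebra_mem_coradical x : (T x \in C0) = (x \in C0).
Proof.
rewrite -{1}coalgebra_image_coradical; apply/idP/idP => [|xC0]; last exact: memv_img.
by case/memv_imgP => y yC0 E; have /lker0P inj := T0; rewrite (inj _ _ E).
Qed.

Lemma annihilates_comp f : annihilates f C0 -> annihilates (f \o T)%VF C0.
Proof. by move=> fJ x xC0; rewrite comp_lfunE fJ // coalgebra_mem_coradical. Qed.

Lemma annihilates_comp_inv f : annihilates f C0 -> annihilates (f \o T^-1)%VF C0.
Proof.
move=> fJ x xC0; rewrite comp_lfunE fJ // -coalgebra_mem_coradical.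
by rewrite lker0_lfunVK.
Qed.

Lemma comatrix_map d (c : 'I_d -> 'I_d -> C) : coalgebra_map T -> comatrix c ->
  comatrix (fun i j => T (c i j)).
Proof.
move=> [cT eT] [cM ce [chi chiE]]; split=> [f g i j|i j|].
- rewrite -comp_lfunE cT cM; apply: eq_bigr => l _; by rewrite !comp_lfunE.
- by rewrite -comp_lfunE eT.
exists (fun i j => chi i j \o T^-1)%VF => i j i' j'.
by rewrite comp_lfunE lker0_lfunK.
Qed.

Lemma comatrix_antimap d (c : 'I_d -> 'I_d -> C) : coalgebra_antimap T -> comatrix c ->
  comatrix (fun i j => T (c j i)).
Proof.
move=> [cT eT] [cM ce [chi chiE]]; split=> [f g i j|i j|].
- rewrite -comp_lfunE cT cM; apply: eq_bigr => l _; rewrite !comp_lfunE; exact: mulrC.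
- by rewrite -comp_lfunE eT ce eq_sym.
exists (fun i j => chi j i \o T^-1)%VF => i j i' j'.
by rewrite comp_lfunE lker0_lfunK // chiE andbC.
Qed.

End Image.

(** Choose D' maximal among the subcoalgebras of the coradical meeting D in 0. A simple F meeting D
    + D' in 0 could be added to D', so every simple F lies in D + D'. *)
Lemma simple_complement D : simple_subcoalgebra D ->
  exists D', [/\ subcoalgebra D', (D + D')%VS = C0 & (D :&: D')%VS = 0%VS].
Proof.
move=> simD; have [sD D0 Dmin] := simD.
pose P n := `[< exists D', [/\ subcoalgebra D', (D' <= C0)%VS, (D :&: D')%VS = 0%VS & \dim D' = n] >].
have exP : exists n, P n.
  exists 0%N; apply/asboolP; exists 0%VS; rewrite sub0v capv0 dimv0; split=> //.
  by apply/subcoalgebraP => x; rewrite memv0 => /eqP-> f; rewrite !linear0 mem0v.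
have Ple n : P n -> (n <= \dim {:C})%N by case/asboolP => D' [_ _ _ <-]; apply/dimvS/subvf.
have [n /asboolP[D' [sD' D'C0 DD' dD']] nmax] := ex_maxnP exP Ple.
exists D'; split=> //; apply/eqP; rewrite eqEsubv subv_add D'C0 sumv_pred_sup //=.
apply: sumv_pred_min => F simF; have [sF F0 Fmin] := simF.
have sI := subcoalgebra_cap sF (subcoalgebra_add sD sD').
have [FI|FI] := Fmin _ sI (capvSl _ _); last by rewrite -FI capvSr.
suff /eqP D'F : D' == (D' + F)%VS by rewrite (subv_trans _ (addvSr D D')) // D'F addvSr.
rewrite eqEdim addvSl dD' nmax //; apply/asboolP; exists (D' + F)%VS; split=> //.
- exact: subcoalgebra_add.
- by rewrite subv_add D'C0 sumv_pred_sup.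
apply/eqP; rewrite -subv0; apply/subvP => x; rewrite memv_cap => /andP[xD].
case/memv_addP => a aD' [b bF xE].
have b0 : b = 0.
  apply/eqP; rewrite -memv0 -FI memv_cap bF; apply/memv_addP; exists x => //.
  by exists (- a); rewrite ?memvN // xE addrAC subrr add0r.
by rewrite -DD' memv_cap xD xE b0 addr0.
Qed.

End Bijections.

(** * Injective hulls *)

Section TopComponent.
Variables (k : closedFieldType) (C : coalgType k) (pi : 'End(C)).
Implicit Types (f g : dual C) (x y : C) (D : {vspace C}).
Hypothesis piP : coradical_projection pi.
Local Notation C0 := (@coradical k C).
Local Notation Cn n := (corad_filtration n : {vspace C}).
Local Notation toC0 := (toC0 pi).

(* e is eps on D and 0 on a complementary subcoalgebra of the coradical, composed with pi. *)
Lemma simple_idempotent D : simple_subcoalgebra D -> exists e : dual C,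
  [/\ forall x, x \in D -> e x = eps C x,
      forall f, annihilates f D -> conv e (toC0 f) = 0 &
      forall f, annihilates f D -> conv (toC0 f) e = 0].
Proof.
move=> simD; have [D' [sD' DD' cap0]] := simple_complement simD.
have [sD _ _] := simD; have DC0 : (D <= C0)%VS by rewrite -DD' addvSl.
pose e0 : dual C := (eps C \o daddv_pi D D')%VF.
have eD x : x \in D -> e0 x = eps C x.
  by move=> xD; rewrite comp_lfunE daddv_pi_id.
have eD' x : x \in D' -> e0 x = 0.
  move=> xD'; rewrite comp_lfunE; suff -> : daddv_pi D D' x = 0 by rewrite linear0.
  have xDD' : x \in (D + D')%VS by apply: subvP xD'; apply: addvSr.
  have := daddv_pi_add cap0 xDD'.
  rewrite (daddv_pi_id _ xD'); last by rewrite capvC.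
  by move=> E; apply: (addIr x); rewrite E add0r.
have /subcoalgebraP sDP := sD; have /subcoalgebraP sDP' := sD'.
have splitC0 x : exists a b, [/\ a \in D, b \in D' & pi x = a + b].
  have := pi_coradical piP x; rewrite -DD' => /memv_addP[a aD [b bD' ->]].
  by exists a, b.
exists (toC0 e0); split=> [x xD|f fD|f fD].
- by rewrite toC0E (pi_id piP) ?eD // (subvP DC0).
- rewrite (toC0_conv piP); apply/lfunP => x; rewrite toC0E zero_lfunE.
  have [a [b [aD bD' ->]]] := splitC0 x.
  rewrite linearD /= {1}conv_ract conv_lact fD ?eD' ?addr0 //.
    by have [] := sDP' b bD' f.
  by have [] := sDP a aD e0.
rewrite (toC0_conv piP); apply/lfunP => x; rewrite toC0E zero_lfunE.
have [a [b [aD bD' ->]]] := splitC0 x.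
rewrite linearD /= {1}conv_lact conv_ract fD ?eD' ?addr0 //.
  by have [] := sDP' b bD' f.
by have [] := sDP a aD e0.
Qed.

Section Idempotent.
Variables (D : {vspace C}) (e : dual C).
Hypotheses (eD : forall x, x \in D -> e x = eps C x)
  (ef : forall f, annihilates f D -> conv e (toC0 f) = 0)
  (fe : forall f, annihilates f D -> conv (toC0 f) e = 0).

Lemma ract_idempotent_sub n x :
  (forall f, annihilates f D -> ract f x \in Cn n) -> ract e x - x \in Cn n.
Proof.
move=> xn; rewrite -[in X in _ - X](ract_eps x) -ractB; apply: xn => y yD.
by rewrite add_lfunE opp_lfunE eD // subrr.
Qed.

(** The convolution of e with [toC0 f] is zero, so on the image of [ract e] only the radical part f
    - [toC0 f] acts, and that part lowers the filtration. *)
Lemma ract_idempotent f x : annihilates f D ->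
  ract f (ract e x) = ract (f - toC0 f) (ract e x).
Proof.
move=> fD; rewrite ractB -[ract (toC0 f) _]ract_conv ef //.
by rewrite (linear0_fun (ract_fun_linear x)) subr0.
Qed.

Lemma ract_idempotent_corad n f x : ract e x \in Cn n.+1 -> annihilates f D ->
  ract f (ract e x) \in Cn n.
Proof.
move=> xn fD; rewrite ract_idempotent //.
by have /corad_ractP/(_ _ (toC0_sub_rad piP f)) := xn.
Qed.

Lemma ract_idempotent_coradical f x : ract e x \in C0 -> annihilates f D ->
  ract f (ract e x) = 0.
Proof.
move=> xn fD; rewrite ract_idempotent //; apply: ract_rad xn.
exact: toC0_sub_rad.
Qed.

Variables (L : C) (N : 'End(C)).
Hypotheses (N0 : lker N == 0%VS) (NM : coalgebra_map N)
  (LN : forall f, lact f L = ract (f \o N)%VF L).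

(** Acting by f on one side of L is acting by g = f o N on the other, and g kills D. Its part
    [toC0 g] is absorbed by e; the radical part j returns to the first side as j o N^-1, still
    radical because N preserves the coradical. *)
Lemma lact_idempotent_corad n f : ract e L \in Cn n.+1 -> annihilates f (N @: D) ->
  lact f (ract e L) \in Cn n.
Proof.
move=> yn fND.
have fD : annihilates (f \o N)%VF D by move=> a aD; rewrite comp_lfunE fND ?memv_img.
pose g := (f \o N)%VF; pose j := g - toC0 g.
have jJ : annihilates j C0 by apply: toC0_sub_rad.
have -> : lact f (ract e L) = lact (j \o N^-1)%VF (ract e L).
  rewrite !lact_ract !LN comp_inv // -/g.
  have -> : g = j + toC0 g by rewrite subrK.
  rewrite (linearD_fun j (toC0 g) (ract_fun_linear L)) linearD /=.
  by rewrite -[X in _ + X]ract_conv fe // (linear0_fun (ract_fun_linear L)) addr0.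
have /corad_lactP := yn; apply.
by apply: annihilates_comp_inv => //; left.
Qed.

End Idempotent.
End TopComponent.

(** * The Nakayama automorphism *)

Section Nakayama.
Variables (k : closedFieldType) (H : hopfAlgType k).
Implicit Types (f g : dual H) (x y : H).

(** The equation [lact f L] = [ract (nu f) L] defines a bijection nu of the dual algebra,
    multiplicative because the two actions commute. N is the map on H whose transpose is nu. *)
Lemma nakayama : exists (L : H) (N : 'End(H)),
  [/\ forall x, exists f, lact f L = x, lker N == 0%VS, coalgebra_map N &
      forall f, lact f L = ract (f \o N)%VF L].
Proof.
have [L [Ls Rs Li Ri]] := frobenius_element H.
have Rinj f g : ract f L = ract g L -> f = g.
  by move=> E; apply/eqP; rewrite -subr_eq0; apply/eqP/Ri; rewrite ractB E subrr.
pose nu f := sval (cid (Rs (lact f L))).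
have nuE f : ract (nu f) L = lact f L by rewrite /nu; case: cid.
have nu_lin : linear nu.
  move=> a f g; apply: Rinj.
  by rewrite (ract_fun_linear L) !nuE (lact_fun_linear L).
have lN : linear (fun x => \sum_(i < \dim {:H}) nu (dbasis i) x *: (vbasis {:H})`_i : H) by lin.
pose N := lfun_of lN.
have nuN f : (f \o N)%VF = nu f.
  apply/lfunP => x; rewrite comp_lfunE [N x]lfun_ofE linear_sum /=.
  rewrite [in RHS](dual_dbasis f) (linear_sum_fun _ _ _ nu_lin) sum_lfunE.
  apply: eq_bigr => i _; rewrite (linearZ_fun _ _ nu_lin) scale_lfunE linearZ.
  exact: mulrC.
have LN f : lact f L = ract (f \o N)%VF L by rewrite nuN nuE.
exists L, N; split=> //.
- rewrite -subv0; apply/subvP => x; rewrite memv_ker memv0 => /eqP Nx; apply/eqP.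
  apply: functional_separate => f; rewrite linear0.
  have [g gf] := Ls (ract f L); have -> : f = (g \o N)%VF by apply: Rinj; rewrite -LN.
  by rewrite comp_lfunE Nx linear0.
split=> [f g|]; apply: Rinj.
  by rewrite -LN ract_conv lact_conv -!LN LN -lact_ract -LN.
by rewrite -LN lact_eps ract_eps.
Qed.

End Nakayama.

Lemma antipode_antimap (k : closedFieldType) (H : hopfAlgType k) : coalgebra_antimap (@antipode k H).
Proof.
split=> [f g|]; apply/lfunP => x; rewrite comp_lfunE; last exact: eps_antipode.
rewrite !convE sw_antipode; last by lin.
by apply: eq_tens_elim => a b; rewrite !comp_lfunE; apply: mulrC.
Qed.

(** The antipode exchanges the left and right descriptions of the filtration by radical
    functionals. *)
Lemma antipode_corad (k : closedFieldType) (H : hopfAlgType k) n x :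
  x \in corad_filtration n -> @antipode k H x \in corad_filtration n.
Proof.
have S0 := antipode_bij H; have aS := antipode_antimap H.
elim: n x => [|n IH] x xn; first by rewrite coalgebra_mem_coradical //; right.
apply/corad_ractP => f fJ; rewrite coalgebra_antimap_ract //; apply: IH.
have /corad_lactP := xn; apply.
by apply: annihilates_comp => //; right.
Qed.

(** * Generators and tops of injective hulls *)

Section TopBlock.
Variables (k : closedFieldType) (H : hopfAlgType k) (pi : 'End(H)).
Implicit Types (f g : dual H) (x y : H).
Hypothesis piP : coradical_projection pi.
Local Notation C0 := (@coradical k H).
Local Notation Cn n := (corad_filtration n : {vspace H}).

(* [ract e] projects H onto an injective hull with socle [mxspan c].  By the Frobenius property
   the hull is generated by [ract e y], with y the Frobenius element; m + 1 is its top level. *)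
Lemma injective_hull d (c : 'I_d -> 'I_d -> H) : (0 < d)%N -> comatrix c ->
  exists e : dual H,
  [/\ forall x, x \in mxspan c -> e x = eps H x,
      forall n x, (forall f, annihilates f (mxspan c) -> ract f x \in Cn n) ->
        ract e x - x \in Cn n,
      forall n f x, ract e x \in Cn n.+1 -> annihilates f (mxspan c) ->
        ract f (ract e x) \in Cn n,
      forall f x, ract e x \in C0 -> annihilates f (mxspan c) -> ract f (ract e x) = 0 &
      (forall x, ract e x \in C0) \/
      exists y m (c' : 'I_d -> 'I_d -> H),
        [/\ comatrix c', ract e y \in Cn m.+1 /\ ract e y \notin Cn m,
            forall f, annihilates f (mxspan c) -> ract f (ract e y) \in Cn m,
            forall f, annihilates f (mxspan c') -> lact f (ract e y) \in Cn m &
            forall x, exists f, ract e x = lact f (ract e y)]].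
Proof.
move=> d0 cc; have [e [eD ef fe]] := simple_idempotent piP (comatrix_simple cc d0).
have eC := ract_idempotent_corad piP ef.
exists e; split=> //.
- by move=> n x; apply: ract_idempotent_sub.
- by move=> f x xn fc; apply: (ract_idempotent_coradical piP ef).
have [y [N [ys N0 NM LN]]] := nakayama H.
have gen x : exists f, ract e x = lact f (ract e y).
  by have [f <-] := ys x; exists f; rewrite lact_ract.
have [yC0|/corad_level[m [ym1 ym]]] := boolP (ract e y \in C0).
  left=> x; have [f ->] := gen x; exact: (@corad_lact _ _ 0).
right; exists y, m, (fun i j => N (c i j)); split=> //.
- exact: comatrix_map.
- by move=> f fc; apply: eC.
move=> f fc; apply: (lact_idempotent_corad piP fe N0 NM LN ym1) => _ /memv_imgP[x xc ->].
have /mxspanP[M ->] := xc; rewrite lfun_mxcomb linear_sum big1 // => i _.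
rewrite linear_sum big1 // => j _; rewrite linearZ /= ((annihilates_mxspan _ _).1 fc) //.
exact: mulr0.
Qed.

End TopBlock.

(** * Assembling the nonzero blocks *)

Lemma group_like1 (k : fieldType) (H : hopfAlgType k) : group_like (1 : H).
Proof. by split; [apply: comul1 | apply: counit1]. Qed.

Theorem corollary2p15 (k : closedFieldType) (H : hopfAlgType k)
    (pi : 'End(H)) (Q : nat -> {vspace H}) :
  [pchar k] =i pred0 ->
  ~ cosemisimple H ->
  no_nontrivial_skew_primitives H ->
  coradical_projection pi ->
  block_complements pi Q ->
  exists (tau mu : {vspace H}) (dtau dmu : nat),
    [/\ simple_subcoalgebra tau /\ degree tau dtau,
        simple_subcoalgebra mu /\ degree mu dmu,
        dtau = dmu /\ (1 < dmu)%N,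
        block pi Q 1 dtau 1 <> 0%VS /\ block pi Q 1 1 dtau <> 0%VS &
        exists n m : nat,
          [/\ (1 < n)%N, (1 < m)%N, block pi Q n dtau dmu <> 0%VS
            & block pi Q m 1 1 <> 0%VS]].
Proof.
move=> _ ncs skew piP QP.
pose c1 (_ _ : 'I_1) : H := 1.
have cc1 : comatrix c1 := comatrix_group_like (group_like1 H).
have an1 (f : dual H) : annihilates f (mxspan c1) <-> f 1 = 0.
  by rewrite annihilates_mxspan; split=> [fc|f1 i j //]; apply: (fc 0 0).
have [e [e_eps esub eC e0 e_top]] := injective_hull piP (isT : (0 < 1)%N) cc1.
have [y [m [c1' [cc1' [ym1 ym] yl yr ygen]]]] : exists y m (c' : 'I_1 -> 'I_1 -> H),
    [/\ comatrix c', ract e y \in corad_filtration m.+1 /\ ract e y \notin corad_filtration m,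
        forall f, annihilates f (mxspan c1) -> ract f (ract e y) \in corad_filtration m,
        forall f, annihilates f (mxspan c') -> lact f (ract e y) \in corad_filtration m &
        forall x, exists f, ract e x = lact f (ract e y)].
  (* If the hull stays in the coradical, each f - f(1) eps acts on [ract e x] as zero, so [ract e x]
     = e(x) 1. Thus e is a right integral with e(1) = 1. *)
  case: e_top => // eC0; case: ncs; apply: (@cosemisimple_of_integral _ _ e).
    move=> x; apply: functional_separate => f.
    have /(e0 _ _ (eC0 x)) : annihilates (f - f 1 *: eps H) (mxspan c1).
      by apply/an1; rewrite add_lfunE opp_lfunE scale_lfunE eps1 [_ *: 1]mulr1 subrr.
    rewrite ractB (linearZ_fun _ _ (ract_fun_linear _)) ract_eps.
    move/eqP; rewrite subr_eq0 => /eqP/(congr1 (eps H)).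
    by rewrite eps_ract !linearZ /= eps_ract => ->; apply: mulrC.
  by rewrite e_eps ?eps1 //; apply: (mem_mxspan c1 0 0).
have m0 : (0 < m)%N.
  case: m => // in ym1 ym yl yr *.
  by move/negP: ym; case; apply: (skew_primitive_component piP QP skew cc1 cc1').
have block_m : block pi Q m.+1 1 1 <> 0%VS.
  exact: (block_neq0 piP QP _ _ cc1 cc1' ym1 ym).
(* Descend from the top by radical functionals while the result stays outside the coradical; once
   all of them lead into the coradical, the element lies in C_1. The hull is stable under [lact], so
   w remains in it. *)
have [w [we w1 w0]] : exists w, [/\ w \in limg (ract e), w \in corad_filtration 1 & w \notin @coradical k H].
  have yC0 : ract e y \notin @coradical k H.
    by apply: contra ym => /(subvP (corad_mono H (leq0n m))).
  have : ract e y \in limg (ract e) by rewrite memv_img ?memvf.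
  elim: {yl yr ygen m0 block_m ym} m (ract e y) ym1 yC0 => [|m IH] w wm w0 we.
    by exists w.
  have [[f [fJ fw]]|nf] := pselect (exists f, annihilates f (@coradical k H) /\ lact f w \notin @coradical k H).
    apply: (IH (lact f w)) => //; first by have /corad_lactP/(_ f fJ) := wm.
    have /memv_imgP[x _ ->] := we; rewrite lact_ract.
    by rewrite memv_img ?memvf.
  exists w; split=> //; apply/corad_lactP => f fJ.
  by apply/negPn/negP => fw; apply: nf; exists f.
have stab0 : lact_stable (@coradical k H) by move=> f x; apply: (@corad_lact _ _ 0).
(* A simple subquotient of U above the coradical is a simple constituent of the second layer of the
   hull. *)
pose U := (@coradical k H + (limg (ract e) :&: corad_filtration 1))%VS.
have stabU : lact_stable U.
  move=> f _ /memv_addP[a a0 [b bU ->]]; rewrite linearD /=.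
  apply: memv_add; first exact: stab0.
  move: bU => /memv_capP[/memv_imgP[x _ ->] x1]; apply/memv_capP; split.
    by rewrite lact_ract memv_img ?memvf.
  exact: corad_lact.
have U1 : (U <= corad_filtration 1)%VS by rewrite subv_add (corad_mono H (leq0n 1)) capvSr.
have [|d [c [u [d0 cc uU u0 ul]]]] := simple_subquotient stab0 stabU (addvSl _ _).
  move=> E; move/negP: w0; apply; rewrite -E; apply: subvP (addvSr _ _) _ _.
  by rewrite memv_cap we w1.
pose x := u (Ordinal d0).
have x1 : x \in corad_filtration 1 by apply: subvP U1 _ (uU _).
have x0 : x \notin @coradical k H by apply: u0.
have xr f : annihilates f (mxspan c) -> lact f x \in @coradical k H.
  move=> fc; rewrite -[lact f x](subrK (\sum_i f (c i (Ordinal d0)) *: u i)).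
  rewrite memvD ?ul // big1 ?mem0v // => i _.
  by rewrite (fc _ (mem_mxspan _ _ _)) scale0r.
have xl f : annihilates f (mxspan c1) -> ract f x \in @coradical k H.
  move=> fc; have /memv_addP[a a0 [b]] := uU (Ordinal d0).
  rewrite memv_cap => /andP[/memv_imgP[z _ ->] z1] xE.
  rewrite /x xE linearD /= memvD //; first exact: (@corad_ract _ _ 0).
  exact: (eC 0).
(* Degree one is the skew-primitive case once more, now between 1 and the group-like element of
   [c]. *)
have d1 : (1 < d)%N.
  rewrite ltn_neqAle eq_sym d0 andbT; apply/eqP => dE.
  move/negP: x0; apply; move: {ul uU u0} c cc xr; rewrite dE => c cc xr.
  exact: (skew_primitive_component piP QP skew cc1 cc x1 xl xr).
have block1d : block pi Q 1 1 d <> 0%VS.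
  exact: (block_neq0 piP QP _ d0 cc1 cc x1 x0 xl xr).
(* The antipode exchanges the two legs, so S x has type [cS] on the left and the trivial type on the
   right. *)
pose S := @antipode k H.
have S0 := antipode_bij H; have aS : coalgebra_antimap S := antipode_antimap H.
pose cS i j := S (c j i); have ccS : comatrix cS by apply: comatrix_antimap.
have Sx1 : S x \in corad_filtration 1 by apply: antipode_corad.
have Sx0 : S x \notin @coradical k H by rewrite coalgebra_mem_coradical //; right.
have Sxl f : annihilates f (mxspan cS) -> ract f (S x) \in @coradical k H.
  move=> fc; rewrite coalgebra_antimap_ract //; apply: (@antipode_corad _ _ 0); apply: xr.
  by apply/annihilates_mxspan => i j; rewrite comp_lfunE; apply/fc/(mem_mxspan cS j i).
have Sxr f : annihilates f (mxspan c1) -> lact f (S x) \in @coradical k H.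
  move=> /an1 f1; rewrite coalgebra_antimap_lact //; apply: (@antipode_corad _ _ 0); apply: xl.
  by apply/an1; rewrite comp_lfunE antipode1.
have blockd1 : block pi Q 1 d 1 <> 0%VS.
  exact: (block_neq0 piP QP d0 _ ccS cc1 Sx1 Sx0 Sxl Sxr).
have [e' [e'_eps e'sub _ _ e'_top]] := injective_hull piP d0 ccS.
(* S x has left type [cS], so up to the coradical it lies in the hull attached to [cS]. *)
have eSx : ract e' (S x) - S x \in @coradical k H by apply: (e'sub 0).
case: e'_top => [e'C0|[y' [n [c' [cc' [yn1 yn] yl' yr' ygen']]]]].
  by move/negP: Sx0; case; rewrite -[S x](subKr (ract e' (S x))) memvB ?e'C0.
have n0 : (0 < n)%N.
  case: n => // in yn1 yn yl' yr' *.
  (* Otherwise the span of [c'] would be k1 by simplicity, against its dimension d^2 > 1. *)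
  have one_c' : 1 \notin mxspan c'.
    apply/negP => c'1; have [_ _ min] := comatrix_simple cc' d0.
    have c1c' : (mxspan c1 <= mxspan c')%VS by apply: mxspan_sub.
    have [E|E] := min _ (mxspan_subcoalgebra cc1) c1c'.
      by have [_ ne _] := comatrix_simple cc1 isT; apply: ne.
    have := comatrix_degree cc'; rewrite /degree -E (comatrix_degree cc1).
    by move=> /esym/eqP; rewrite exp1n -[X in _ == X](exp1n 2) eqn_exp2r // gtn_eqF.
  (* Were the top at level one, g would send the generator, hence the whole hull, into the
     coradical, because g followed by any functional still vanishes on [c']. Also eps - g vanishes
     at 1 and so sends S x into the coradical by its trivial right type. Adding the two actions
     would put S x itself in the coradical. *)
  have [g gc' g1] := separating_functional one_c'.
  have gSx : lact g (S x) \in @coradical k H.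
    rewrite -[S x](subKr (ract e' (S x))) linearB /= memvB //; last exact: stab0.
    have [f ->] := ygen' (S x); rewrite -lact_conv; apply: yr' => a ac'.
    rewrite conv_lact gc' //.
    by have /subcoalgebraP/(_ a ac' f)[] := mxspan_subcoalgebra cc'.
  move/negP: Sx0; case; rewrite -[S x]lact_eps.
  have -> : eps H = (eps H - g) + g by rewrite subrK.
  rewrite (linearD_fun _ _ (lact_fun_linear _)) memvD // Sxr //.
  by apply/an1; rewrite add_lfunE opp_lfunE eps1 g1 subrr.
exists (mxspan cS), (mxspan c'), d, d; split=> //.
- by split; [apply: comatrix_simple | apply: comatrix_degree].
- by split; [apply: comatrix_simple | apply: comatrix_degree].
(* The tops sit one level above [n] and [m], both of which were shown to be positive. *)
exists n.+1, m.+1; split=> //.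
exact: (block_neq0 piP QP d0 d0 ccS cc' yn1 yn).
Qed.
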